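(* Let $W_2^3[a,T]$, $W_2^1[a,T]$, $L$, $F$, the sequence $\{x_i\}_{i=1}^\infty$ of pairwise distinct points of $[a,T]$, the functions $\psi_i$, the orthonormal functions $\bar\psi_i$ and the orthogonalization coefficients $\beta_{ik}$ be as defined in the context. Then for each $v\in W_2^3[a,T]$ the series $\sum_{i=1}^{\infty}\langle v,\bar\psi_i\rangle_{W_2^3}\,\bar\psi_i$ converges in the norm of $W_2^3[a,T]$. Moreover, if $\{x_i\}_{i=1}^\infty$ is dense in $[a,T]$ and $u\in W_2^3[a,T]$ is the exact solution of $$Lu(x)=F(x,u(x)),\quad a<x<T,\qquad u(a)=0,\ u'(a)=0,$$ then: (i) $u$ is represented by $$u(x)=\sum_{i=1}^{\infty}\sum_{k=1}^{i}\beta_{ik}\,F(x_k,u(x_k))\,\bar\psi_i(x);$$ (ii) for the approximate solutions $$u_n(x)=\sum_{i=1}^{n}\sum_{k=1}^{i}\beta_{ik}\,F(x_k,u(x_k))\,\bar\psi_i(x),\qquad n\ge 1,$$ the derivatives $u_n^{(j)}$ converge uniformly on $[a,T]$ to $u^{(j)}$ as $n\to\infty$, for $j=0,1,2$.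
   Context: Let $a<T$ and $k$ be real constants. $W_2^3[a,T]$ is the space of real functions $u$ on $[a,T]$ such that $u''$ exists and is absolutely continuous on $[a,T]$, $u'''\in L^2[a,T]$, and $u(a)=u'(a)=0$, with inner product $\langle u,v\rangle_{W_2^3}=\sum_{i=0}^{2}u^{(i)}(a)v^{(i)}(a)+\int_a^T u'''(s)v'''(s)\,ds$ and norm $\|u\|_{W_2^3}=\sqrt{\langle u,u\rangle_{W_2^3}}$. It is a reproducing kernel Hilbert space. $W_2^1[a,T]$ is the space of absolutely continuous real functions $u$ on $[a,T]$ with $u'\in L^2[a,T]$, with inner product $\langle u,v\rangle_{W_2^1}=u(a)v(a)+\int_a^T u'(t)v'(t)\,dt$. It is a reproducing kernel Hilbert space; its reproducing kernel is denoted $G_x(y)$. $L:W_2^3[a,T]\to W_2^1[a,T]$ is the operator $Lu(x)=u''(x)+\frac{k}{x}u'(x)$ (at $x=0$, if $0\in[a,T]$, the value is understood by continuity). It is a standing assumption that $L$ is a well-defined bounded linear operator between these spaces and that it is injective. The function $F:[a,T]\times\mathbb{R}\to\mathbb{R}$ is analytic (in particular continuous), with $x\mapsto F(x,y(x))$ in $W_2^1[a,T]$ whenever $y\in W_2^3[a,T]$, and such that the initial value problem $Lu(x)=F(x,u(x))$ for $a<x<T$, $u(a)=u'(a)=0$, has a unique solution $u\in W_2^3[a,T]$, this solution being analytic. Given a sequence $\{x_i\}_{i=1}^\infty$ of pairwise distinct points of $[a,T]$, put $\varphi_i=G_{x_i}$ and $\psi_i=L^*\varphi_i\in W_2^3[a,T]$,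 where $L^*$ is the adjoint of $L$; equivalently $\langle u,\psi_i\rangle_{W_2^3}=Lu(x_i)$ for all $u\in W_2^3[a,T]$. The orthonormal system $\{\bar\psi_i\}_{i=1}^\infty$ is obtained from $\{\psi_i\}_{i=1}^\infty$ by Gram-Schmidt orthonormalization in $W_2^3[a,T]$: $\bar\psi_i=\sum_{k=1}^{i}\beta_{ik}\psi_k$ with $\beta_{ii}>0$. *)

(* Defs.v *)
From HB Require Import structures.
From mathcomp Require Import all_boot all_order all_algebra.
From mathcomp Require Import all_classical all_reals all_analysis.

Set Implicit Arguments.
Unset Strict Implicit.
Unset Printing Implicit Defensive.

Import Order.TTheory GRing.Theory Num.Theory.
Import numFieldNormedType.Exports.

Local Open Scope classical_set_scope.
Local Open Scope ring_scope.

(* A function on [a, b] is represented by a total function R -> R of which only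
   the values on [a, b] matter: none of the notions below depends on the other
   values, and equality of such functions is pointwise equality on [a, b].  *)

Section derivative_on_segment.
Context {R : realType}.
Implicit Types (a b x l : R) (f : R -> R).

(* The difference quotient is restricted to [a, b], so that the derivative at
   an endpoint is the one-sided one. *)
Definition is_deriv_on a b f x l : Prop :=
  (f y - f x) / (y - x) @[y --> within `[a, b]%classic x^'] --> l.

(* The value is 0 where the limit does not exist. *)
Definition deriv_on a b f x : R :=
  lim ((f y - f x) / (y - x) @[y --> within `[a, b]%classic x^']).

Definition derivn_on a b (j : nat) f : R -> R := iter j (deriv_on a b) f.

Definition derivable_on a b f : Prop :=
  forall x, x \in `[a, b] -> exists l, is_deriv_on a b f x l.

Definition abs_continuous a b f : Prop :=
  forall e : R, 0 < e -> exists2 d : R, 0 < d &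
    forall (n : nat) (s t : 'I_n -> R),
      (forall i, [/\ a <= s i, s i <= t i & t i <= b]) ->
      trivIset [set: 'I_n] (fun i => `]s i, t i[%classic) ->
      \sum_(i < n) (t i - s i) < d ->
      \sum_(i < n) `|f (t i) - f (s i)| < e.

(* f' exists almost everywhere on [a, b] and belongs to L^2[a, b]; since
   elements of L^2 are classes modulo equality a.e., this is expressed with a
   measurable representative g of f'. *)
Definition deriv_in_L2 a b f : Prop :=
  exists2 g : R -> R, g \in Lfun (@lebesgue_measure R) 2%:E &
    {ae @lebesgue_measure R, forall x, x \in `[a, b] ->
      is_deriv_on a b f x (g x)}.

Definition analytic_on a b f : Prop :=
  forall x0, x0 \in `[a, b] -> exists (c : nat -> R) (r : R), 0 < r /\
    forall x, x \in `[a, b] -> `|x - x0| < r ->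
      pseries c (x - x0) @ \oo --> f x.

(* Around each point of [a, b] x R, F is the sum of an absolutely convergent
   double power series, whose terms are grouped by total degree. *)
Definition analytic2_on a b (F : R -> R -> R) : Prop :=
  forall x0 y0, x0 \in `[a, b] ->
  exists (c : nat -> nat -> R) (r : R), 0 < r /\
    forall x y, x \in `[a, b] -> `|x - x0| < r -> `|y - y0| < r ->
      let term n (i : 'I_n.+1) :=
        c i (n - i)%N * (x - x0) ^+ i * (y - y0) ^+ (n - i) in
      cvgn (series (fun n => \sum_(i < n.+1) `|term n i|)) /\
      series (fun n => \sum_(i < n.+1) term n i) @ \oo --> F x y.

End derivative_on_segment.

Section spaces.
Context {R : realType}.
Implicit Types (a T : R) (u v : R -> R).

Definition W23 a T u : Prop :=
  [/\ derivable_on a T u /\ derivable_on a T (deriv_on a T u),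
      abs_continuous a T (derivn_on a T 2 u),
      deriv_in_L2 a T (derivn_on a T 2 u)
    & u a = 0 /\ deriv_on a T u a = 0].

Definition ipW23 a T u v : R :=
  \sum_(i < 3) derivn_on a T i u a * derivn_on a T i v a +
  \int[@lebesgue_measure R]_(s in `[a, T])
    (derivn_on a T 3 u s * derivn_on a T 3 v s).

Definition normW23 a T u : R := Num.sqrt (ipW23 a T u u).

Definition W21 a T u : Prop := abs_continuous a T u /\ deriv_in_L2 a T u.

Definition ipW21 a T u v : R :=
  u a * v a +
  \int[@lebesgue_measure R]_(s in `[a, T]) (deriv_on a T u s * deriv_on a T v s).

Definition normW21 a T u : R := Num.sqrt (ipW21 a T u u).

Definition reproducing_kernelW21 a T (G : R -> R -> R) : Prop :=
  forall x, x \in `[a, T] ->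
    W21 a T (G x) /\ forall u, W21 a T u -> ipW21 a T u (G x) = u x.

End spaces.

Section operators.
Context {R : realType}.
Implicit Types (a T k : R) (u v : R -> R) (L Ls : (R -> R) -> R -> R).

(* At 0 the value is the limit within [a, T]; if L u belongs to W21, it is
   continuous on [a, T], so that this limit does exist when 0 is in [a, T]. *)
Definition Lop a T k u (x : R) : R :=
  let e y := derivn_on a T 2 u y + k / y * deriv_on a T u y in
  if x == 0 then lim (e y @[y --> within `[a, T]%classic 0^']) else e x.

Definition bounded_linear_op a T L : Prop :=
  [/\ forall u, W23 a T u -> W21 a T (L u),
      forall (c : R) u v, W23 a T u -> W23 a T v ->
        {in `[a, T], L (fun x => c * u x + v x) =1
                     (fun x => c * L u x + L v x)}
    & exists C : R, forall u, W23 a T u ->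
        normW21 a T (L u) <= C * normW23 a T u].

Definition injective_op a T L : Prop :=
  forall u v, W23 a T u -> W23 a T v ->
    {in `[a, T], L u =1 L v} -> {in `[a, T], u =1 v}.

Definition adjoint_op a T L Ls : Prop :=
  forall v, W21 a T v -> W23 a T (Ls v) /\
    forall u, W23 a T u -> ipW21 a T (L u) v = ipW23 a T u (Ls v).

Definition IVP_solution a T k (F : R -> R -> R) u : Prop :=
  [/\ W23 a T u,
      forall x, a < x < T -> Lop a T k u x = F x (u x),
      u a = 0
    & deriv_on a T u a = 0].

End operators.

Section gram_schmidt.
Context {R : realType}.
Variables (ip : (R -> R) -> (R -> R) -> R) (psi : nat -> R -> R).

Definition gs_normalize (w : R -> R) : R -> R :=
  fun t => w t / Num.sqrt (ip w w).

(* The sequence of the first n orthonormalized functions. *)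
Fixpoint gs_seq (n : nat) : seq (R -> R) :=
  if n is m.+1 then
    let s := gs_seq m in
    rcons s (gs_normalize
      (fun t => psi m t - \sum_(e <- s) ip (psi m) e * e t))
  else [::].

Definition gram_schmidt (i : nat) : R -> R := nth (fun=> 0) (gs_seq i.+1) i.

End gram_schmidt.

(* Main.v *)
Require Import Defs.
From HB Require Import structures.
From mathcomp Require Import all_boot all_order all_algebra.
From mathcomp Require Import all_classical all_reals all_analysis.
From mathcomp Require Import measurable_realfun ring lra.
Import Order.TTheory GRing.Theory Num.Theory.
Import numFieldNormedType.Exports.
Local Open Scope classical_set_scope.
Local Open Scope ring_scope.

Set Implicit Arguments.
Unset Strict Implicit.

(* Since functions are only identified on the segment, both inner products are
   merely positive semidefinite forms, which suffices for the Hilbert space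
   arguments.  Bessel's inequality makes the Fourier sums Cauchy, and W_2^3 is
   complete because u |-> u'' is an isometry onto W_2^1 (the values u(a) and
   u'(a) vanish), whose completeness is Riesz-Fischer plus Lebesgue
   differentiation.  The limit w of the Fourier series of u satisfies
   <u - w, psi_i> = L(u - w)(x_i) = 0, so u = w by density and injectivity of L.
   Point evaluations on W_2^1 are bounded, with a bound read off the given
   reproducing kernel, so norm convergence controls u''_n uniformly, and the mean
   value theorem then controls u'_n and u_n. *)

(** * Gram-Schmidt orthonormalization for a positive semidefinite form *)

(** Two obstacles shape the proof. The integrands of the inner products are values of [deriv_on],
    which is a genuine derivative only almost everywhere, has a default value elsewhere, and does
    not come with a proof of measurability. Each such integral is therefore moved to an L^2
    representative of the derivative, by an a.e. equality of integrals that applies to arbitrary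
    functions. Secondly, Gram-Schmidt divides by a norm that may vanish for a semidefinite form, so
    each vector of the system has squared norm 0 or 1; a null vector is orthogonal to everything by
    Cauchy-Schwarz, which keeps the usual expansions valid. The coefficients involving [F] are
    Fourier coefficients: <u, psibar_i> = sum_j beta_ij <u, psi_j> = sum_j beta_ij Lu(x_j), and
    Lu(x_j) = F(x_j, u(x_j)). The equation is given on the open interval only, while a node may be
    an endpoint, so it is first extended to the closed segment by continuity of both sides. *)

Section semi_inner_product.
Context {R : realType}.
Variables (V : (R -> R) -> Prop) (ip : (R -> R) -> (R -> R) -> R).

Record semi_inner_product : Prop := SemiInnerProduct {
  sip_closed : forall (c : R) u v, V u -> V v -> V (fun x => c * u x + v x);
  sip_sym : forall u v, ip u v = ip v u;
  sip_linear : forall (c : R) u v w, V u -> V v -> V w ->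
    ip (fun x => c * u x + v x) w = c * ip u w + ip v w;
  sip_ge0 : forall u, V u -> 0 <= ip u u }.

Hypothesis ipP : semi_inner_product.
Implicit Types u v w : R -> R.

Lemma sip_linear_r (c : R) u v w : V u -> V v -> V w ->
  ip w (fun x => c * u x + v x) = c * ip w u + ip w v.
Proof.
move=> Vu Vv Vw; rewrite sip_sym// (sip_linear ipP)//.
by rewrite !(sip_sym ipP _ w).
Qed.

Lemma sip_closed0 u : V u -> V (fun=> 0).
Proof.
move=> Vu; rewrite (_ : (fun=> 0) = fun x => -1 * u x + u x).
  exact: sip_closed.
by apply/funext => x /=; lra.
Qed.

Lemma sip_closedZ (c : R) u : V u -> V (fun x => c * u x).
Proof.
move=> Vu; rewrite (_ : (fun x => _) = fun x => c * u x + (fun=> 0) x).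
  apply: (sip_closed ipP) => //; exact: sip_closed0 Vu.
by apply/funext => x /=; rewrite addr0.
Qed.

Lemma sip_closedB u v : V u -> V v -> V (fun x => u x - v x).
Proof.
move=> Vu Vv; rewrite (_ : (fun x => _) = fun x => -1 * v x + u x).
  exact: sip_closed.
by apply/funext => x /=; lra.
Qed.

Lemma sip0l u w : V u -> V w -> ip (fun=> 0) w = 0.
Proof.
move=> Vu Vw; rewrite (_ : (fun=> 0) = fun x => -1 * u x + u x).
  by rewrite (sip_linear ipP)//; lra.
by apply/funext => x /=; lra.
Qed.

Lemma sipZl (c : R) u w : V u -> V w -> ip (fun x => c * u x) w = c * ip u w.
Proof.
move=> Vu Vw; rewrite (_ : (fun x => _) = fun x => c * u x + (fun=> 0) x).
  have V0 := sip_closed0 Vu.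
  by rewrite (sip_linear ipP)// (sip0l Vu)// addr0.
by apply/funext => x /=; rewrite addr0.
Qed.

Lemma sipBl u v w : V u -> V v -> V w ->
  ip (fun x => u x - v x) w = ip u w - ip v w.
Proof.
move=> Vu Vv Vw; rewrite (_ : (fun x => _) = fun x => -1 * v x + u x).
  by rewrite (sip_linear ipP)//; lra.
by apply/funext => x /=; lra.
Qed.

Lemma sipBr u v w : V u -> V v -> V w ->
  ip w (fun x => u x - v x) = ip w u - ip w v.
Proof. by move=> *; rewrite sip_sym// sipBl// !(sip_sym ipP w). Qed.

Lemma sip_closed_sum n (c : nat -> R) (f : nat -> R -> R) :
  (forall i, V (f i)) -> V (fun x => \sum_(i < n) c i * f i x).
Proof.
move=> Vf; elim: n => [|n IH].
  rewrite (_ : (fun x => _) = fun=> 0); first exact: sip_closed0 (Vf 0).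
  by apply/funext => x; rewrite big_ord0.
rewrite (_ : (fun x => _) = fun x => c n * f n x + \sum_(i < n) c i * f i x).
  exact: (sip_closed ipP).
by apply/funext => x; rewrite big_ord_recr/= addrC.
Qed.

Lemma sip_suml n (c : nat -> R) (f : nat -> R -> R) w :
  (forall i, V (f i)) -> V w ->
  ip (fun x => \sum_(i < n) c i * f i x) w = \sum_(i < n) c i * ip (f i) w.
Proof.
move=> Vf Vw; elim: n => [|n IH].
  rewrite (_ : (fun x => _) = fun=> 0); first by rewrite (sip0l (Vf 0)) ?big_ord0.
  by apply/funext => x; rewrite big_ord0.
rewrite (_ : (fun x => _) = fun x => c n * f n x + \sum_(i < n) c i * f i x).
  rewrite (sip_linear ipP)//; last exact: sip_closed_sum.
  by rewrite IH big_ord_recr/= addrC.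
by apply/funext => x; rewrite big_ord_recr/= addrC.
Qed.

Lemma sip_sumr n (c : nat -> R) (f : nat -> R -> R) w :
  (forall i, V (f i)) -> V w ->
  ip w (fun x => \sum_(i < n) c i * f i x) = \sum_(i < n) c i * ip w (f i).
Proof.
move=> Vf Vw; rewrite sip_sym// sip_suml//.
by apply: eq_bigr => i _; rewrite (sip_sym ipP w).
Qed.

(** The quadratic t |-> ip (t u + v) (t u + v) is nonnegative. If its leading coefficient vanishes
    it is affine, so its slope must be 0; otherwise it is evaluated at its minimizer. *)
Lemma sip_cauchy_schwarz u v : V u -> V v ->
  ip u v ^+ 2 <= ip u u * ip v v.
Proof.
move=> Vu Vv.
have q t : 0 <= t ^+ 2 * ip u u + 2 * t * ip u v + ip v v.
  have Vw := sip_closed ipP t Vu Vv.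
  have := sip_ge0 ipP Vw; rewrite (sip_linear ipP)// !sip_linear_r//.
  rewrite (sip_sym ipP v u); congr (_ <= _); ring.
have := sip_ge0 ipP Vu; rewrite le_eqVlt => /predU1P[u0|u0].
  rewrite -u0 mul0r; have [->|uv0] := eqVneq (ip u v) 0; first by rewrite expr0n.
  (* At this t the affine function would take the value -1. *)
  have := q (- (ip v v + 1) / (2 * ip u v)); rewrite -u0 mulr0 add0r.
  rewrite (_ : 2 * (_ / _) * ip u v = - (ip v v + 1)); last by field.
  by lra.
have := q (- ip u v / ip u u).
rewrite (_ : _ + _ = (ip u u * ip v v - ip u v ^+ 2) / ip u u).
  by rewrite pmulr_lge0 ?invr_gt0// subr_ge0.
by field; rewrite gt_eqF.
Qed.

Lemma sip_null u v : V u -> V v -> ip u u = 0 -> ip u v = 0.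
Proof.
move=> Vu Vv u0; have := sip_cauchy_schwarz Vu Vv; rewrite u0 mul0r => uv0.
by apply/eqP; rewrite -sqrf_eq0 eq_le uv0 sqr_ge0.
Qed.

(** * Orthogonality, Bessel's inequality and Fourier sums for the Gram-Schmidt system *)

Section gram_schmidt_theory.
Variable psi : nat -> R -> R.
Hypothesis Vpsi : forall i, V (psi i).
Let e := gram_schmidt ip psi.

Lemma size_gs_seq n : size (gs_seq ip psi n) = n.
Proof. by elim: n => //= n IH; rewrite size_rcons IH. Qed.

Lemma nth_gs_seq n i : (i < n)%N -> nth (fun=> 0) (gs_seq ip psi n) i = e i.
Proof.
elim: n => // n IH; rewrite ltnS leq_eqVlt => /predU1P[->//|ni].
by rewrite [gs_seq _ _ _]/= nth_rcons size_gs_seq ni IH.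
Qed.

Definition gs_residue m t := psi m t - \sum_(i < m) ip (psi m) (e i) * e i t.

Lemma gram_schmidtE m : e m = fun t => gs_residue m t /
  Num.sqrt (ip (gs_residue m) (gs_residue m)).
Proof.
rewrite /e /gram_schmidt [gs_seq _ _ _]/= nth_rcons size_gs_seq ltnn eqxx.
rewrite (_ : (fun t => psi m t - \sum_(f <- gs_seq ip psi m) ip (psi m) f * f t) =
  gs_residue m)//.
apply/funext => t; rewrite /gs_residue; congr (_ - _).
rewrite (big_nth (fun=> 0)) size_gs_seq big_mkord.
by apply: eq_bigr => i _; rewrite nth_gs_seq.
Qed.

Let gram_schmidt_closed_ltn n : forall m, (m < n)%N -> V (e m) /\ V (gs_residue m).
Proof.
elim: n => // n IH m; rewrite ltnS leq_eqVlt => /predU1P[->|]; last exact: IH.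
suff Vr : V (gs_residue n).
  split=> //; rewrite gram_schmidtE (_ : (fun t => _) = fun t =>
    (Num.sqrt (ip (gs_residue n) (gs_residue n)))^-1 * gs_residue n t).
    exact: sip_closedZ.
  by apply/funext => t; rewrite mulrC.
(* [sip_closed_sum] wants a whole sequence in [V], whereas the induction covers only the indices
   below [n]; the rest is padded with [psi n]. *)
pose f i := if (i < n)%N then e i else psi n.
rewrite (_ : gs_residue n =
  fun t => psi n t - \sum_(i < n) ip (psi n) (e i) * f i t).
  apply: sip_closedB => //.
  apply: (@sip_closed_sum n (fun i => ip (psi n) (e i))) => i.
  by rewrite /f; case: ifP => // /IH[].
apply/funext => t; rewrite /gs_residue; congr (_ - _).
by apply: eq_bigr => i _; rewrite /f ltn_ord.
Qed.

Lemma gram_schmidt_closed m : V (e m).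
Proof. by have [] := @gram_schmidt_closed_ltn m.+1 m (ltnSn m). Qed.

Lemma gs_residue_closed m : V (gs_residue m).
Proof. by have [] := @gram_schmidt_closed_ltn m.+1 m (ltnSn m). Qed.

Lemma gram_schmidt_sipl m w : V w ->
  ip (e m) w = ip (gs_residue m) w /
    Num.sqrt (ip (gs_residue m) (gs_residue m)).
Proof.
move=> Vw; have Vr := gs_residue_closed m.
rewrite gram_schmidtE (_ : (fun t => _) = fun t =>
    (Num.sqrt (ip (gs_residue m) (gs_residue m)))^-1 * gs_residue m t).
  by rewrite sipZl// mulrC.
by apply/funext => t; rewrite mulrC.
Qed.

(* The value 0 occurs when [psi m] depends on its predecessors, since
   [gs_normalize] then divides by 0. *)
Lemma gram_schmidt_norm m : ip (e m) (e m) = 0 \/ ip (e m) (e m) = 1.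
Proof.
have Vr := gs_residue_closed m; have Ve := gram_schmidt_closed m.
rewrite gram_schmidt_sipl// (sip_sym ipP) gram_schmidt_sipl//.
set N := ip _ _; have N0 : 0 <= N by exact: sip_ge0.
have [->|N1] := eqVneq N 0; first by left; rewrite !mul0r.
right; rewrite -mulrA -invfM -expr2 sqr_sqrtr// mulfV//.
Qed.

(** If [e m] is null, both sides vanish by Cauchy-Schwarz. This replaces normalization in the
    computations below, without a case split on null vectors. *)
Lemma gram_schmidt_norm_absorb m w : V w ->
  ip w (e m) * ip (e m) (e m) = ip w (e m).
Proof.
move=> Vw; have Ve := gram_schmidt_closed m.
have [e0|->] := gram_schmidt_norm m; last by rewrite mulr1.
by rewrite (sip_sym ipP w) (@sip_null (e m))// mul0r.
Qed.

Lemma gram_schmidt_orthogonal i j : i != j -> ip (e i) (e j) = 0.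
Proof.
have Ve := gram_schmidt_closed.
(* The induction is on a bound for the larger index, so that all pairs of smaller indices are
   available when the residue of [i] is expanded. There only the term with index [j] survives, and
   it cancels [ip (psi i) (e j)]. *)
suff H n : forall i j, (j < i)%N -> (i < n)%N -> ip (e i) (e j) = 0.
  rewrite neq_ltn => /orP[] ij; last exact: (H i.+1).
  by rewrite (sip_sym ipP); exact: (H j.+1).
elim: n => // n IH {}i {}j ji; rewrite ltnS => ni.
rewrite gram_schmidt_sipl//.
rewrite [X in X / _](_ : _ = 0) ?mul0r//.
rewrite /gs_residue sipBl//; last first.
  exact: (@sip_closed_sum i (fun k => ip (psi i) (e k))).
rewrite (@sip_suml i (fun k => ip (psi i) (e k)))//.
rewrite (bigD1 (Ordinal ji))//= big1 ?addr0 ?gram_schmidt_norm_absorb ?subrr//.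
move=> k; rewrite -val_eqE/= neq_ltn => /orP[] kj.
  by rewrite (sip_sym ipP (e k)) IH ?mulr0// (leq_trans ji).
by rewrite IH ?mulr0// (leq_trans (ltn_ord k)).
Qed.

(** [psi m] is its residue plus a combination of earlier [e i]. The residue is either null, hence
    orthogonal to [z], or a nonzero multiple of [e m]. *)
Lemma gram_schmidt_total z : V z -> (forall i, ip z (e i) = 0) ->
  forall i, ip z (psi i) = 0.
Proof.
move=> Vz z0 m; have Ve := gram_schmidt_closed; have Vr := gs_residue_closed m.
have : ip z (gs_residue m) = 0.
  have := z0 m; rewrite (sip_sym ipP) gram_schmidt_sipl// (sip_sym ipP z).
  set N := ip _ (gs_residue m); have [N0 _|N0] := eqVneq N 0.
    exact: sip_null N0.
  move=> /eqP; rewrite mulf_eq0 invr_eq0 sqrtr_eq0 => /orP[/eqP//|].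
  by rewrite leNgt lt_def N0 sip_ge0.
rewrite /gs_residue sipBr//; last first.
  exact: (@sip_closed_sum m (fun k => ip (psi m) (e k))).
rewrite (@sip_sumr m (fun k => ip (psi m) (e k)))//.
by rewrite big1 ?subr0// => i _; rewrite z0 mulr0.
Qed.

Definition fourier_sum v n t := \sum_(i < n) ip v (e i) * e i t.

Lemma fourier_sum_closed v n : V (fourier_sum v n).
Proof. exact: (@sip_closed_sum n (fun k => ip v (e k))) gram_schmidt_closed. Qed.

Lemma sip_fourier_sum v n j : V v ->
  ip (fourier_sum v n) (e j) = if (j < n)%N then ip v (e j) else 0.
Proof.
move=> Vv; have Ve := gram_schmidt_closed.
rewrite (@sip_suml n (fun k => ip v (e k)))//; case: ifPn => [jn|].
  rewrite (bigD1 (Ordinal jn))//= big1 ?addr0 ?gram_schmidt_norm_absorb//.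
  by move=> k kj; rewrite gram_schmidt_orthogonal ?mulr0.
rewrite -leqNgt => nj; rewrite big1// => k _.
by rewrite gram_schmidt_orthogonal ?mulr0// ltn_eqF// (leq_trans (ltn_ord k)).
Qed.

Lemma sip_fourier_sum2 v n m : V v -> (n <= m)%N ->
  ip (fourier_sum v n) (fourier_sum v m) = \sum_(i < n) ip v (e i) ^+ 2.
Proof.
move=> Vv nm; have Ve := gram_schmidt_closed.
rewrite (sip_sym ipP) (@sip_sumr n (fun k => ip v (e k)))//; last first.
  exact: fourier_sum_closed.
apply: eq_bigr => i _; rewrite sip_fourier_sum//.
by rewrite (leq_trans (ltn_ord i)) ?expr2.
Qed.

Lemma fourier_sum_dist v n m : V v -> (n <= m)%N ->
  ip (fun t => fourier_sum v m t - fourier_sum v n t)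
     (fun t => fourier_sum v m t - fourier_sum v n t) =
  \sum_(i < m) ip v (e i) ^+ 2 - \sum_(i < n) ip v (e i) ^+ 2.
Proof.
move=> Vv nm; have Vs := fourier_sum_closed v.
rewrite sipBl ?sipBr//; last exact: sip_closedB.
rewrite (sip_sym ipP (_ m) (_ n)) !sip_fourier_sum2//; lra.
Qed.

Lemma bessel v n : V v -> \sum_(i < n) ip v (e i) ^+ 2 <= ip v v.
Proof.
move=> Vv; have Ve := gram_schmidt_closed; have Vs := fourier_sum_closed v n.
have Vd := sip_closedB Vv Vs.
have := sip_ge0 ipP Vd; rewrite sipBl// !sipBr// sip_fourier_sum2//.
rewrite (sip_sym ipP _ v) (@sip_sumr n (fun k => ip v (e k)))//.
under [X in ip v v - X]eq_bigr do rewrite -expr2.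
lra.
Qed.

(** By [fourier_sum_dist] the squared distance of two Fourier sums is a difference of partial sums
    of the squared coefficients; these increase and are bounded by Bessel's inequality. *)
Lemma fourier_sum_cauchy v : V v -> forall eps : R, 0 < eps ->
  exists N, forall m n, (N <= m)%N -> (N <= n)%N ->
    ip (fun t => fourier_sum v m t - fourier_sum v n t)
       (fun t => fourier_sum v m t - fourier_sum v n t) < eps.
Proof.
move=> Vv eps eps0; have Vs := fourier_sum_closed v.
pose s n := \sum_(i < n) ip v (e i) ^+ 2.
have nd : nondecreasing_seq s.
  apply/nondecreasing_seqP => n; rewrite /s big_ord_recr/= lerDl; exact: sqr_ge0.
have : cvgn s.
  apply: nondecreasing_is_cvgn => //; exists (ip v v) => _ [n _ <-]; exact: bessel.
move=> /cvgrPdist_lt /(_ (eps / 2)) []; first by rewrite divr_gt0.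
move=> N _ HN.
exists N => m n Nm Nn.
wlog nm : m n Nm Nn / (n <= m)%N => [H|].
  have /orP[|] := leq_total n m; first exact: H.
  move=> mn; have := H _ _ Nn Nm mn.
  have Vd := sip_closedB (Vs m) (Vs n).
  have -> : (fun t => fourier_sum v n t - fourier_sum v m t) =
    (fun t => -1 * (fourier_sum v m t - fourier_sum v n t)).
    by apply/funext => t; lra.
  rewrite (sipZl _ Vd); last exact: sip_closedZ.
  rewrite (sip_sym ipP) (sipZl _ Vd)//.
  by rewrite mulN1r mulN1r opprK.
rewrite fourier_sum_dist//; have /= := HN m Nm; have /= := HN n Nn.
rewrite !ltr_distl /s; lra.
Qed.

(** For n > j the n-th Fourier sum has the same inner product with [e j] as [v]. Hence <v - w, e_j>
    is the inner product of [e j] with the n-th sum minus [w], which Cauchy-Schwarz makes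
    arbitrarily small. *)
Lemma fourier_limit_orthogonal v w : V v -> V w ->
  (forall eps : R, 0 < eps -> exists n0, forall n, (n0 <= n)%N ->
     ip (fun t => fourier_sum v n t - w t) (fun t => fourier_sum v n t - w t)
       < eps) ->
  forall i, ip (fun t => v t - w t) (psi i) = 0.
Proof.
move=> Vv Vw sw; have Ve := gram_schmidt_closed.
apply: gram_schmidt_total; first exact: sip_closedB.
move=> j; apply/eqP; rewrite -sqrf_eq0; apply/eqP/le_anti.
rewrite sqr_ge0 andbT; apply/ler_addgt0Pl => eps eps0; rewrite addr0.
have [n0 /(_ (maxn n0 j.+1) (leq_maxl _ _))] := sw _ eps0.
set n := maxn _ _ => sn.
have Vs := fourier_sum_closed v n.
have -> : ip (fun t => v t - w t) (e j) =
          ip (fun t => fourier_sum v n t - w t) (e j).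
  by rewrite !sipBl// sip_fourier_sum// leq_maxr.
have Vd := sip_closedB Vs Vw.
apply: le_trans (sip_cauchy_schwarz Vd (Ve j)) _.
apply: le_trans (ltW sn).
have d0 := sip_ge0 ipP Vd.
by have [->|->] := gram_schmidt_norm j; rewrite ?mulr0 ?mulr1.
Qed.

End gram_schmidt_theory.

End semi_inner_product.

(** * Derivatives on a segment *)

Section derivatives_on_segment.
Context {R : realType}.
Variables (a b : R).
Hypothesis ab : a < b.
Implicit Types (f g : R -> R) (x l : R).

Lemma is_deriv_onP f x l : is_deriv_on a b f x l <->
  forall e : R, 0 < e -> exists2 d : R, 0 < d &
    forall y, y \in `[a, b] -> y != x -> `|y - x| < d ->
      `|(f y - f x) / (y - x) - l| < e.
Proof.
split=> [/cvgrPdist_lt H e e0|H].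
  have [d /= d0 Hd] := H _ e0; exists d => // y yab yx yd.
  by rewrite distrC; apply: Hd => //=; rewrite distrC.
apply/cvgrPdist_lt => e e0; have [d d0 Hd] := H _ e0.
exists d => //= y /= yd yab yx; rewrite distrC; apply: Hd => //.
by rewrite distrC.
Qed.

(** Limits along this filter are thus unique, so [deriv_on] returns the derivative whenever there is
    one. Nearby points of the segment lie to the right of [x], or to the left when x = b. *)
Lemma dnbhs_segment_proper x : x \in `[a, b] ->
  ProperFilter (within `[a, b]%classic x^').
Proof.
rewrite in_itv/= => /andP[ax xb]; apply: Build_ProperFilter_ex => P [d /= d0 Hd].
have [xltb|bx] := ltP x b.
  pose m := Num.min (d / 2) (b - x).
  have m0 : 0 < m by rewrite lt_min divr_gt0// subr_gt0.
  have md : m < d by rewrite gt_min; apply/orP; left; lra.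
  have mb : m <= b - x by rewrite ge_min lexx orbT.
  exists (x + m); apply: Hd => /=.
  - by rewrite opprD addrA subrr add0r normrN gtr0_norm.
  - by rewrite gt_eqF// ltrDl.
  - by rewrite in_itv/=; apply/andP; split; lra.
pose m := Num.min (d / 2) (b - a).
have m0 : 0 < m by rewrite lt_min divr_gt0// subr_gt0.
have md : m < d by rewrite gt_min; apply/orP; left; lra.
have mb : m <= b - a by rewrite ge_min lexx orbT.
have xb' : x = b by apply/le_anti; rewrite xb.
exists (b - m); apply: Hd => /=.
- by rewrite xb' opprB addrCA subrr addr0 gtr0_norm.
- by rewrite lt_eqF// xb' ltrBlDr ltrDl.
- by rewrite in_itv/=; apply/andP; split; lra.
Qed.

Lemma deriv_onE f x l : x \in `[a, b] -> is_deriv_on a b f x l ->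
  deriv_on a b f x = l.
Proof. by move=> xab fl; have ? := dnbhs_segment_proper xab; exact/cvg_lim. Qed.

Lemma is_deriv_on_ext f g x l : {in `[a, b], f =1 g} -> x \in `[a, b] ->
  is_deriv_on a b f x l -> is_deriv_on a b g x l.
Proof.
move=> fg xab /is_deriv_onP H; apply/is_deriv_onP => e /H[d d0 Hd].
by exists d => // y yab; rewrite -!fg//; exact: Hd.
Qed.

(** The filters of difference quotients coincide, so the equality also covers the points without
    derivative, where [lim] gives its default value. *)
Lemma deriv_on_ext f g : {in `[a, b], f =1 g} ->
  {in `[a, b], deriv_on a b f =1 deriv_on a b g}.
Proof.
move=> fg x xab; rewrite /deriv_on; congr (lim _).
rewrite eqEsubset; split => P.
  move=> [d /= d0 Hd]; exists d => //= y yd yx yab /=; rewrite -!fg//.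
  exact: Hd.
move=> [d /= d0 Hd]; exists d => //= y yd yx yab /=; rewrite !fg//.
exact: Hd.
Qed.

Lemma derivn_on_ext n f g : {in `[a, b], f =1 g} ->
  {in `[a, b], derivn_on a b n f =1 derivn_on a b n g}.
Proof. by move=> fg; elim: n => //= n IH; exact: deriv_on_ext. Qed.

Lemma is_deriv_on_linear (c : R) f g x l m : is_deriv_on a b f x l ->
  is_deriv_on a b g x m ->
  is_deriv_on a b (fun y => c * f y + g y) x (c * l + m).
Proof.
move=> fl gm; rewrite /is_deriv_on.
rewrite (_ : (fun y => _) = (fun y => c * ((f y - f x) / (y - x)) +
   ((g y - g x) / (y - x)))); last by apply/funext => y /=; lra.
by apply: cvgD => //; apply: cvgM => //; exact: cvg_cst.
Qed.

Lemma deriv_on_is_deriv f : derivable_on a b f ->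
  forall x, x \in `[a, b] -> is_deriv_on a b f x (deriv_on a b f x).
Proof. by move=> df x xab; have [l fl] := df _ xab; rewrite (deriv_onE xab fl). Qed.

Lemma derivable_on_linear (c : R) f g : derivable_on a b f ->
  derivable_on a b g -> derivable_on a b (fun y => c * f y + g y).
Proof.
move=> df dg x xab; have [l fl] := df _ xab; have [m gm] := dg _ xab.
by exists (c * l + m); exact: is_deriv_on_linear.
Qed.

Lemma deriv_on_linear (c : R) f g : derivable_on a b f -> derivable_on a b g ->
  {in `[a, b], deriv_on a b (fun y => c * f y + g y) =1
     (fun y => c * deriv_on a b f y + deriv_on a b g y)}.
Proof.
move=> df dg x xab; apply: deriv_onE => //; apply: is_deriv_on_linear;
  exact: deriv_on_is_deriv.
Qed.

Lemma derivable_on_ext f g : {in `[a, b], f =1 g} ->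
  derivable_on a b f -> derivable_on a b g.
Proof.
by move=> fg df x xab; have [l fl] := df _ xab; exists l; exact: is_deriv_on_ext fl.
Qed.

Lemma abs_continuous_ext f g : {in `[a, b], f =1 g} ->
  abs_continuous a b f -> abs_continuous a b g.
Proof.
move=> fg acf e /acf[d d0 H]; exists d => // n s t st dis sd.
rewrite (eq_bigr (fun i => `|f (t i) - f (s i)|)); first exact: H.
move=> i _; have [? ? ?] := st i.
by rewrite !fg// in_itv/=; apply/andP; split=> //; lra.
Qed.

Lemma abs_continuous_linear (c : R) f g : abs_continuous a b f ->
  abs_continuous a b g -> abs_continuous a b (fun x => c * f x + g x).
Proof.
move=> acf acg e e0.
(* Each function gets half of [e]; the added 1 keeps the divisor positive when c = 0. *)
have k0 : 0 < 2 * (`|c| + 1) by have := normr_ge0 c; lra.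
have [d1 d10 H1] := acf _ (divr_gt0 e0 k0).
have [|d2 d20 H2] := acg (e / 2); first by rewrite divr_gt0.
exists (Num.min d1 d2); first by rewrite lt_min d10.
move=> n s t st dis; rewrite lt_min => /andP[sd1 sd2].
have F := H1 _ _ _ st dis sd1; have G := H2 _ _ _ st dis sd2.
apply: (@le_lt_trans _ _ (`|c| * \sum_(i < n) `|f (t i) - f (s i)| +
   \sum_(i < n) `|g (t i) - g (s i)|)).
  rewrite mulr_sumr -big_split/=; apply: ler_sum => i _.
  rewrite -normrM; apply: le_trans (ler_normD _ _).
  by rewrite mulrBr opprD addrACA.
have S0 : 0 <= \sum_(i < n) `|f (t i) - f (s i)| by apply: sumr_ge0.
apply: (@lt_le_trans _ _ ((`|c| + 1) * (e / (2 * (`|c| + 1))) + e / 2)).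
  apply: ler_ltD => //; apply: ler_pM => //; [by rewrite lerDl|exact: ltW].
rewrite (_ : _ + _ = e)//; field; have := normr_ge0 c; lra.
Qed.

(** Absolute continuity for a family consisting of the single interval between [x] and [y]. *)
Lemma abs_continuous_dist f : abs_continuous a b f ->
  forall x, x \in `[a, b] -> forall e : R, 0 < e -> exists2 d : R, 0 < d &
    forall y, y \in `[a, b] -> `|y - x| < d -> `|f y - f x| < e.
Proof.
move=> acf x xab e e0; have [d d0 H] := acf _ e0; exists d => // y yab yx.
wlog xy : x y xab yab yx / x <= y => [W|].
  have /orP[|] := le_total x y; first exact: W.
  by move=> yx'; rewrite distrC; apply: W => //; rewrite distrC.
move: xab yab; rewrite !in_itv/= => /andP[ax xb] /andP[ay yb].
have := H 1%N (fun=> x) (fun=> y).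
rewrite !big_ord1; apply => //; last 2 first.
  by move=> i j _ _ _; rewrite !ord1.
by move: yx; rewrite ger0_norm ?subr_ge0.
Qed.

(** Names the representative that [deriv_in_L2] hides under an existential, so that inner products
    can be computed with it. *)
Definition L2_deriv f f' := f' \in Lfun (@lebesgue_measure R) 2%:E /\
  {ae @lebesgue_measure R, forall x, x \in `[a, b] -> is_deriv_on a b f x (f' x)}.

Lemma L2_deriv_linear (c : R) f g f' g' : L2_deriv f f' -> L2_deriv g g' ->
  L2_deriv (fun x => c * f x + g x) (fun x => c * f' x + g' x).
Proof.
move=> [Lf ff'] [Lg gg']; split.
  have -> : (fun x => c * f' x + g' x) = (c \o* f') \+ g'.
    by apply/funext => x /=; rewrite mulrC.
  have p1 : (1 <= 2%:E :> \bar R)%E by rewrite lee_fin; lra.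
  have := Lfun_addr_closed lebesgue_measure p1.
  by case=> _ ->//; apply: Lfun_scale => //; lra.
have aeF := ae_filter_ringOfSetsType (@lebesgue_measure R).
apply: filterS2 ff' gg' => x fx gx xab.
by apply: is_deriv_on_linear; [exact: fx|exact: gx].
Qed.

Lemma deriv_in_L2_linear (c : R) f g : deriv_in_L2 a b f -> deriv_in_L2 a b g ->
  deriv_in_L2 a b (fun x => c * f x + g x).
Proof.
move=> [f' L2f ff'] [g' L2g gg']; exists (fun x => c * f' x + g' x).
  by have [] := L2_deriv_linear c (conj L2f ff') (conj L2g gg').
by have [] := L2_deriv_linear c (conj L2f ff') (conj L2g gg').
Qed.

Lemma deriv_in_L2_ext f g : {in `[a, b], f =1 g} ->
  deriv_in_L2 a b f -> deriv_in_L2 a b g.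
Proof.
move=> fg [f' L2f ff']; exists f' => //.
have aeF := ae_filter_ringOfSetsType (@lebesgue_measure R).
apply: filterS ff' => x fx xab.
by apply: (is_deriv_on_ext fg xab); exact: fx.
Qed.

Lemma W21_linear (c : R) f g : W21 a b f -> W21 a b g ->
  W21 a b (fun x => c * f x + g x).
Proof.
move=> [acf df] [acg dg]; split; first exact: abs_continuous_linear.
exact: deriv_in_L2_linear.
Qed.

Lemma W21_ext f g : {in `[a, b], f =1 g} -> W21 a b f -> W21 a b g.
Proof.
move=> fg [acf df]; split; first exact: abs_continuous_ext acf.
exact: deriv_in_L2_ext df.
Qed.

Lemma W23_derivn2 f : W23 a b f -> W21 a b (derivn_on a b 2 f).
Proof. by case. Qed.

Lemma derivn_on_linear (c : R) f g j : (j <= 2)%N -> W23 a b f -> W23 a b g ->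
  {in `[a, b], derivn_on a b j (fun y => c * f y + g y) =1
     (fun y => c * derivn_on a b j f y + derivn_on a b j g y)}.
Proof.
move=> j2 [[df1 df2] _ _ _] [[dg1 dg2] _ _ _].
move: j j2 => [|[|[|//]]] _ x xab //=; first exact: deriv_on_linear.
rewrite (deriv_on_ext (deriv_on_linear c df1 dg1))//.
exact: deriv_on_linear.
Qed.

Lemma W23_linear (c : R) f g : W23 a b f -> W23 a b g ->
  W23 a b (fun x => c * f x + g x).
Proof.
move=> Wf Wg; have D := derivn_on_linear c _ Wf Wg.
case: (Wf) => [[df1 df2] acf Lf [fa dfa]].
case: (Wg) => [[dg1 dg2] acg Lg [ga dga]].
have aab : a \in `[a, b] by rewrite in_itv/= lexx ltW.
split.
- split; first exact: derivable_on_linear.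
  apply: (@derivable_on_ext (fun y => c * deriv_on a b f y + deriv_on a b g y)).
    by move=> x xab; rewrite [RHS](D 1%N).
  exact: derivable_on_linear.
- apply: (@abs_continuous_ext (fun y =>
    c * derivn_on a b 2 f y + derivn_on a b 2 g y)).
    by move=> x xab; rewrite [RHS](D 2%N).
  exact: abs_continuous_linear.
- apply: (@deriv_in_L2_ext (fun y =>
    c * derivn_on a b 2 f y + derivn_on a b 2 g y)).
    by move=> x xab; rewrite [RHS](D 2%N).
  exact: deriv_in_L2_linear.
- have := D 1%N isT a aab; rewrite /derivn_on/= dfa dga => ->.
  by rewrite fa ga mulr0 addr0.
Qed.

Lemma ipW21_ext f g h : {in `[a, b], f =1 g} -> ipW21 a b f h = ipW21 a b g h.
Proof.
move=> fg; rewrite /ipW21; have aab : a \in `[a, b] by rewrite in_itv/= lexx ltW.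
rewrite fg//; congr (_ + _); apply: eq_Rintegral => x xab.
by rewrite (deriv_on_ext fg)//; move: xab; rewrite inE.
Qed.

Lemma ipW21C f g : ipW21 a b f g = ipW21 a b g f.
Proof.
rewrite /ipW21 mulrC; congr (_ + _); apply: eq_Rintegral => x _.
by rewrite mulrC.
Qed.

Lemma ipW23E f g : W23 a b f -> W23 a b g ->
  ipW23 a b f g = ipW21 a b (derivn_on a b 2 f) (derivn_on a b 2 g).
Proof.
move=> [_ _ _ [fa dfa]] [_ _ _ [ga dga]]; rewrite /ipW23 /ipW21.
by rewrite !big_ord_recr big_ord0/= fa dfa !mul0r !add0r.
Qed.

Lemma ipW23_ext f g h : {in `[a, b], f =1 g} -> ipW23 a b f h = ipW23 a b g h.
Proof.
move=> fg; rewrite /ipW23; have aab : a \in `[a, b] by rewrite in_itv/= lexx ltW.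
apply: (f_equal2 +%R).
  apply: eq_bigr => i _.
  have E := derivn_on_ext i fg aab.
  by rewrite E.
apply: eq_Rintegral => x; rewrite inE => xab.
have E := derivn_on_ext 3 fg xab.
by rewrite E.
Qed.

Lemma ipW23C f g : ipW23 a b f g = ipW23 a b g f.
Proof.
apply: (f_equal2 +%R); first by apply: eq_bigr => i _; exact: mulrC.
by apply: eq_Rintegral => x _; exact: mulrC.
Qed.

End derivatives_on_segment.

(** * Integrals modulo null sets and completeness of L^2 *)

Section ae_integral.
Import HBNNSimple.
Context d (T : measurableType d) (R : realType) (mu : {measure set T -> \bar R}).
Local Open Scope ereal_scope.

(* Unlike [ge0_ae_eq_integral], no measurability is assumed: a simple function
   below [f] can be cut off on a measurable null set so as to lie below [g]. *)
Let ge0_ae_le_integralT (f g : T -> \bar R) : (forall x, 0 <= f x) ->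
  (forall x, 0 <= g x) -> {ae mu, forall x, f x = g x} ->
  \int[mu]_x f x <= \int[mu]_x g x.
Proof.
move=> f0 g0 [N [mN N0 fgN]]; rewrite !ge0_integralTE//.
apply: ge_ereal_sup => _ [h /= hf <-].
have mNC : measurable (~` N) by exact: measurableC.
pose h' := proj_nnsfun h mNC.
have h'E x : h' x = (h \_ (~` N)) x by rewrite (mrestrict h mNC).
rewrite (_ : sintegral mu h = sintegral mu h').
  apply: ereal_sup_ubound; exists h' => // x; change ((h' x)%:E <= g x).
  rewrite h'E patchE; case: ifPn => [/set_mem xN|_]; last exact: g0.
  have <- : f x = g x by apply: contrapT => fg; exact/xN/fgN.
  exact: hf.
rewrite -!integralT_nnsfun; apply: ge0_ae_eq_integral => //.
- exact/measurable_EFinP.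
- exact/measurable_EFinP.
- by move=> x _; rewrite lee_fin.
- by move=> x _; rewrite lee_fin.
exists N; split=> // x /= /not_implyP[_ hx]; apply: contrapT => xN; apply: hx.
by change ((h x)%:E = (h' x)%:E); rewrite h'E patchE mem_set.
Qed.

(** This is what allows [deriv_on] under an integral to be replaced by an L^2 representative. The
    positive and negative parts are compared separately. *)
Lemma ae_eq_integral_nonmeasurable (D : set T) (f g : T -> \bar R) :
  {ae mu, forall x, D x -> f x = g x} ->
  \int[mu]_(x in D) f x = \int[mu]_(x in D) g x.
Proof.
move=> fg; rewrite integralE [RHS]integralE.
have aeF := ae_filter_ringOfSetsType mu.
have H (p q : T -> \bar R) : (forall x, 0 <= p x) -> (forall x, 0 <= q x) ->
    {ae mu, forall x, D x -> p x = q x} ->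
    \int[mu]_(x in D) p x = \int[mu]_(x in D) q x.
  move=> p0 q0 pq; rewrite integral_mkcond [RHS]integral_mkcond.
  by apply/le_anti/andP; split; apply: ge0_ae_le_integralT;
    (try by move=> x; rewrite patchE; case: ifP);
    apply: filterS pq => x pqx; rewrite !patchE; case: ifPn => // /set_mem/pqx.
congr (_ - _); apply: H => //; apply: filterS fg => x fg /fg.
  by rewrite !funeposE => ->.
by rewrite !funenegE => ->.
Qed.

Lemma ae_eq_Rintegral_nonmeasurable (D : set T) (f g : T -> R) :
  {ae mu, forall x, D x -> f x = g x} ->
  (\int[mu]_(x in D) f x = \int[mu]_(x in D) g x)%R.
Proof.
move=> fg; rewrite /Rintegral; congr fine; apply: ae_eq_integral_nonmeasurable.
have aeF := ae_filter_ringOfSetsType mu.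
by apply: filterS fg => x fg /fg ->.
Qed.

End ae_integral.

(** Weighted AM-GM: |d_k| <= 2^-k + 2^k d_k^2, and both terms on the right have bounded partial
    sums. *)
Lemma series_abs_cvg (R : realType) (d : nat -> R) (M : R) :
  (forall n, \sum_(k < n) 2 ^+ k * d k ^+ 2 <= M) -> cvgn (series d).
Proof.
move=> dM; apply: normed_cvg; apply: nondecreasing_is_cvgn.
  apply/nondecreasing_seqP => n; rewrite /= !seriesEord/= big_ord_recr/= lerDl.
  exact: normr_ge0.
exists (2 + M) => _ [n _ <-]; rewrite /= seriesEord.
apply: (@le_trans _ _ (\sum_(k < n) ((2^-1) ^+ k + 2 ^+ k * d k ^+ 2))).
  apply: ler_sum => k _.
  have p0 : 0 < 2 ^+ k :> R by rewrite exprn_gt0.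
  rewrite -(ler_pM2l p0) mulrDr exprVn mulfV ?gt_eqF// -real_normK ?num_real//.
  by have := sqr_ge0 (2 ^+ k * `|d k| - 1); have := sqr_ge0 (2 ^+ k * `|d k|); nra.
rewrite big_split/=; apply: lerD; last exact: dM.
have -> m : \sum_(k < m) (2^-1) ^+ k = 2 - 2 * (2^-1) ^+ m :> R.
  elim: m => [|m IH]; first by rewrite big_ord0 expr0; lra.
  by rewrite big_ord_recr/= IH exprS; lra.
have : 0 <= (2^-1) ^+ n :> R by rewrite exprn_ge0.
lra.
Qed.

(** * Completeness of L^2 *)

Section riesz_fischer.
Context d (T : measurableType d) (R : realType) (mu : {measure set T -> \bar R}).
Variable f : nat -> T -> R.
Hypothesis mf : forall n, measurable_fun setT (f n).
Hypothesis cauchy_f : forall e : R, 0 < e -> exists N, forall m n,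
  (N <= m)%N -> (N <= n)%N -> (\int[mu]_x ((f m x - f n x) ^+ 2)%:E < e%:E)%E.

(** Along a fast subsequence the sum [S] of the weighted squared increments is integrable, hence
    finite almost everywhere. At such points [series_abs_cvg] makes the increments summable, and the
    sequence is recovered by telescoping. *)
Lemma riesz_fischer_subsequence : exists n_ : nat -> nat,
  (forall K, exists k0, forall k, (k0 <= k)%N -> (K <= n_ k)%N) /\
  {ae mu, forall x, cvgn (fun k => f (n_ k) x)}.
Proof.
(* The factor 2^-k compensates the weight 2^k in [S]; the factors 2^-(k+1) that remain sum to at
   most 1. *)
have /choice[N HN] k : exists N, forall m n, (N <= m)%N -> (N <= n)%N ->
    (\int[mu]_x ((f m x - f n x) ^+ 2)%:E < ((2^-1) ^+ k * (2^-1) ^+ k.+1)%:E)%E.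
  by apply: cauchy_f; rewrite mulr_gt0// exprn_gt0.
(* Summing the thresholds makes [n_] monotone and at least [N k]; the successors also give k <= n_
   k. *)
pose n_ k := (\sum_(i < k.+1) (N i).+1)%N.
have n_N k : (N k <= n_ k)%N.
  by rewrite /n_ big_ord_recr/=; exact: leq_trans (leqnSn _) (leq_addl _ _).
have n_S k : (n_ k <= n_ k.+1)%N by rewrite /n_ [leqRHS]big_ord_recr/= leq_addr.
have n_k k : (k <= n_ k)%N.
  elim: k => // k IH; rewrite /n_ big_ord_recr/= addnS ltnS.
  by rewrite (leq_trans IH)// leq_addr.
exists n_; split.
  by move=> K; exists K => k Kk; exact: leq_trans (n_k k).
pose D k x := f (n_ k.+1) x - f (n_ k) x.
pose S x := (\sum_(k <oo) (2 ^+ k * D k x ^+ 2)%:E)%E.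
have mD k : measurable_fun setT (fun x => (2 ^+ k * D k x ^+ 2)%:E).
  apply/measurable_EFinP; apply: measurable_funM => //.
  by apply: measurable_funX; exact: measurable_funB.
have D0 k x : (0 <= (2 ^+ k * D k x ^+ 2)%:E)%E.
  by rewrite lee_fin mulr_ge0// sqr_ge0.
have intS : mu.-integrable setT S.
  apply/integrableP; split.
    by apply: ge0_emeasurable_sum => // *; exact: D0.
  under eq_integral do rewrite gee0_abs ?nneseries_ge0//.
  rewrite integral_nneseries//.
  apply: (@le_lt_trans _ _ 1%E); last exact: ltry.
  apply: lime_le; first by apply: is_cvg_nneseries => *; exact: integral_ge0.
  apply: nearW => m; rewrite big_mkord.
  apply: (@le_trans _ _ (\sum_(k < m) ((2^-1) ^+ k.+1)%:E)%E).
    apply: lee_sum => k _.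
    have p0 : 0 < 2 ^+ k :> R by rewrite exprn_gt0.
    under eq_integral do rewrite EFinM.
    rewrite ge0_integralZl//; last 2 first.
    - by apply/measurable_EFinP; apply: measurable_funX; exact: measurable_funB.
    - by move=> x _; rewrite lee_fin sqr_ge0.
    rewrite (le_trans (y := ((2 ^+ k)%:E * ((2^-1) ^+ k * (2^-1) ^+ k.+1)%:E)%E))//.
      by rewrite lee_pmul2l ?lte_fin// ltW// HN// (leq_trans (n_N k)).
    by rewrite -EFinM mulrA -exprMn mulfV// expr1n mul1r.
  rewrite sumEFin lee_fin.
  have -> l : \sum_(k < l) (2^-1) ^+ k.+1 = 1 - (2^-1) ^+ l :> R.
    elim: l => [|l IH]; first by rewrite big_ord0 expr0; lra.
    by rewrite big_ord_recr/= IH exprS; lra.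
  by rewrite gerBl exprn_ge0.
have aeF := ae_filter_ringOfSetsType mu.
have := integrable_ae measurableT intS; apply: filterS => x /(_ I) Sx.
have : cvgn (series (D ^~ x)).
  apply: (@series_abs_cvg _ _ (fine (S x))) => n.
  rewrite -lee_fin fineK// -sumEFin -(big_mkord xpredT (fun k => (2 ^+ k * D k x ^+ 2)%:E)).
  by apply: nneseries_lim_ge => *; exact: D0.
move=> cD.
have -> : (fun k => f (n_ k) x) = (fun k => series (D^~ x) k + f (n_ 0%N) x).
  apply/funext => k; rewrite /series/= /D telescope_sumr//; lra.
by apply: is_cvgD => //; exact: is_cvg_cst.
Qed.

(** Fatou's lemma is applied in k to the squares of f_n - f_(n_k), whose limit is (f_n - h)^2 almost
    everywhere. *)
Theorem riesz_fischer : exists h : T -> R, measurable_fun setT h /\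
  forall e : R, 0 < e -> exists N, forall n, (N <= n)%N ->
    (\int[mu]_x ((f n x - h x) ^+ 2)%:E <= e%:E)%E.
Proof.
have [n_ [n_oo cvf]] := riesz_fischer_subsequence.
(* The upper limit is measurable everywhere and equals the limit of the subsequence wherever that
   exists. *)
pose h x := fine (limn_esup (fun k => (f (n_ k) x)%:E)).
have mh : measurable_fun setT h.
  apply: (@measurableT_comp _ _ _ _ _ _ (@fine R)) => //.
  by apply: measurable_fun_limn_esup => k; exact/measurable_EFinP.
exists h; split=> // e e0; have [N HN] := cauchy_f e0; exists N => n Nn.
pose F k x := ((f n x - f (n_ k) x) ^+ 2)%:E.
have mF k : measurable_fun setT (F k).
  by apply/measurable_EFinP; apply: measurable_funX; exact: measurable_funB.
have F0 k x : (0 <= F k x)%E by rewrite lee_fin sqr_ge0.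
rewrite (_ : integral _ _ _ = (\int[mu]_x limn_einf (F ^~ x))%E); last first.
  have aeF := ae_filter_ringOfSetsType mu.
  apply: ae_eq_integral_nonmeasurable; apply: filterS cvf => x cx _.
  have /cvg_ex[l cl] := cx.
  have hl : h x = l.
    rewrite /h (_ : limn_esup _ = l%:E)//.
    have /cvg_limn_einf_sup[_ ->//] : (f (n_ k) x)%:E @[k --> \oo] --> l%:E.
    by apply/fine_cvgP; split => //; exact: nearW.
  rewrite hl.
  have : F k x @[k --> \oo] --> ((f n x - l) ^+ 2)%:E.
    apply/fine_cvgP; split; first exact: nearW.
    under eq_cvg do rewrite /= expr2.
    by rewrite expr2; apply: cvgM; apply: cvgB => //; exact: cvg_cst.
  by move=> /cvg_limn_einf_sup[-> _].
apply: le_trans (fatou mu measurableT mF _) _; first by move=> *; exact: F0.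
have [k0 Hk0] := n_oo N.
rewrite limn_einf_lim; apply: lime_le; first exact: is_cvg_einfs.
exists k0 => // k /= k0k; apply: (@le_trans _ _ (\int[mu]_x F k x)%E).
  by apply: ereal_inf_lbound; exists k => /=.
by apply: ltW; apply: HN => //; exact: Hk0.
Qed.

End riesz_fischer.

(** * The space W_2^1 *)

Section square_integrable.
Context {R : realType}.
Notation mu := (@lebesgue_measure R).
Implicit Types f g : R -> R.

Lemma Lfun2_measurable f : f \in Lfun mu 2%:E -> measurable_fun setT f.
Proof. by move=> /[!inE] /andP[/[!inE]]. Qed.

Lemma Lfun2P f : measurable_fun setT f ->
  mu.-integrable setT (EFin \o (fun x => f x ^+ 2)) -> f \in Lfun mu 2%:E.
Proof.
move=> mf /integrableP[_ fi]; rewrite inE; apply/andP; rewrite !inE; split=> //=.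
rewrite /finite_norm unlock poweR_lty//.
apply: le_lt_trans fi; rewrite le_eqVlt; apply/orP; left; apply/eqP.
apply: eq_integral => x _ /=; congr EFin.
by rewrite powR_mulrn// normrX.
Qed.

Lemma Lfun2_integrableM (D : set R) f g : measurable D ->
  f \in Lfun mu 2%:E -> g \in Lfun mu 2%:E ->
  mu.-integrable D (EFin \o (fun x => f x * g x)).
Proof.
move=> mD Lf Lg; apply: (@integrableS _ _ _ _ setT) => //.
exact/Lfun1_integrable/Lfun2_mul_Lfun1.
Qed.

(** On a bounded segment |f| <= 1 + f^2 is an integrable bound. *)
Lemma Lfun2_integrable_segment (a b : R) f :
  f \in Lfun mu 2%:E -> mu.-integrable `[a, b] (EFin \o f).
Proof.
move=> Lf; have mf := Lfun2_measurable Lf.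
have i1 : mu.-integrable `[a, b] (EFin \o cst 1).
  apply: continuous_compact_integrable; first exact: segment_compact.
  by apply: continuous_subspaceT => x; exact: cst_continuous.
have i2 := Lfun2_integrableM (measurable_itv `[a, b]) Lf Lf.
apply: (le_integrable _ _ _ (integrableD _ i1 i2)) => //.
  by apply/measurable_EFinP; exact: measurable_funTS.
move=> x _ /=; rewrite lee_fin [leRHS]ger0_norm; last first.
  by rewrite addr_ge0// -expr2 sqr_ge0.
by rewrite -expr2 -real_normK ?num_real//; have := sqr_ge0 (`|f x| - 1); nra.
Qed.

End square_integrable.

Section W21_theory.
Context {R : realType}.
Notation mu := (@lebesgue_measure R).
Variables (a b : R).
Hypothesis ab : a < b.
Implicit Types f g h : R -> R.

Lemma W21_L2_deriv f : W21 a b f -> exists f', L2_deriv a b f f'.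
Proof. by move=> [_ [f' Lf' ff']]; exists f'. Qed.

Lemma ipW21_L2_deriv f g f' g' : L2_deriv a b f f' -> L2_deriv a b g g' ->
  ipW21 a b f g = f a * g a + \int[mu]_(x in `[a, b]) (f' x * g' x).
Proof.
move=> [_ ff'] [_ gg']; rewrite /ipW21; congr (_ + _).
apply: ae_eq_Rintegral_nonmeasurable.
have aeF := ae_filter_ringOfSetsType mu.
apply: filterS2 ff' gg' => x fx gx xab.
by rewrite (deriv_onE ab xab (fx xab)) (deriv_onE ab xab (gx xab)).
Qed.

Lemma W21_sip : semi_inner_product (W21 a b) (ipW21 a b).
Proof.
split.
- by move=> *; exact: W21_linear.
- exact: ipW21C.
- move=> c u v w Wu Wv Ww.
  have [u' uu'] := W21_L2_deriv Wu; have [v' vv'] := W21_L2_deriv Wv.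
  have [w' ww'] := W21_L2_deriv Ww; have uv' := L2_deriv_linear c uu' vv'.
  rewrite (ipW21_L2_deriv uv' ww') (ipW21_L2_deriv uu' ww').
  rewrite (ipW21_L2_deriv vv' ww').
  have iu := Lfun2_integrableM (measurable_itv `[a, b]) uu'.1 ww'.1.
  have iv := Lfun2_integrableM (measurable_itv `[a, b]) vv'.1 ww'.1.
  rewrite (_ : Rintegral _ _ _ = \int[mu]_(x in `[a, b])
      (c * (u' x * w' x) + v' x * w' x)); last first.
    by apply: eq_Rintegral => x _; rewrite mulrDl mulrA.
  rewrite RintegralD//; last first.
    have : mu.-integrable `[a, b] (fun x => c%:E * (u' x * w' x)%:E)%E.
      by apply: integrableZl => //; exact: iu.
    by [].
  by rewrite RintegralZl//; lra.
- move=> u Wu; apply: addr_ge0; first by rewrite -expr2 sqr_ge0.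
  by apply: Rintegral_ge0 => x _; rewrite -expr2 sqr_ge0.
Qed.

Lemma derivable_is_deriv_on f (x l : R) : derivable f x 1 /\ derive1 f x = l ->
  is_deriv_on a b f x l.
Proof.
move=> [df <-].
have : (fun y : R => y^-1 *: (f (y + x) - f x)) @ 0^' --> derive1 f x.
  rewrite /derive1; move: df; rewrite /derivable /=.
  by under eq_fun do rewrite [_%:A]mulr1.
move=> /cvgrPdist_lt H; apply/is_deriv_onP => e e0.
have [d /= d0 Hd] := H _ e0; exists d => // y yab yx yd.
have := Hd (y - x); rewrite /= sub0r normrN subr_eq0 subrK.
by move=> /(_ yd yx); rewrite distrC [X in `|X - _|]mulrC.
Qed.

Section primitive.
Variable g : R -> R.
Hypothesis Lg : g \in Lfun mu 2%:E.
(** Cut off outside the segment, [g] is integrable on the whole line, so that a primitive starting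
    at -oo can be used. *)
Let h := g \_ `[a, b].

Let inth : mu.-integrable setT (EFin \o h).
Proof.
rewrite /h -restrict_EFin; apply/integrable_restrict => //.
by rewrite setTI; exact: Lfun2_integrable_segment.
Qed.

Let inthS (D : set R) : measurable D -> mu.-integrable D (EFin \o h).
Proof. by move=> mD; exact: integrableS inth. Qed.

Let P x := \int[mu]_(t in `]-oo, x]) h t.

Let PB s t : s <= t -> P t - P s = \int[mu]_(x in `]s, t[) h x.
Proof.
move=> st; rewrite Rintegral_itvB ?bnd_simp//; last exact: inthS.
by rewrite Rintegral_itv_bndo_bndc//; exact: inthS.
Qed.

(** The disjoint intervals have a union whose measure is the sum of their lengths, and the integral
    of |h| is small on sets of small measure. *)
Let P_abs_cont (e : R) : 0 < e -> exists2 d : R, 0 < d &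
  forall (n : nat) (s t : 'I_n -> R), (forall i, s i <= t i) ->
    trivIset [set: 'I_n] (fun i => `]s i, t i[%classic) ->
    \sum_(i < n) (t i - s i) < d -> \sum_(i < n) `|P (t i) - P (s i)| < e.
Proof.
move=> e0; have [d [d0 H]] := integral_normr_continuous inth e0.
exists d => // n s t st dis sd.
pose A := \big[setU/set0]_(i <- index_enum 'I_n) `]s i, t i[%classic.
have mA : measurable A by apply: bigsetU_measurable.
have dis' : trivIset [set` index_enum 'I_n] (fun i : 'I_n => `]s i, t i[%classic).
  by move=> i j _ _; exact: dis.
have /(H _ mA) {}H : (mu A < d%:E)%E.
  rewrite -[mu A]mul1e -integral_cst// ge0_integral_bigsetU//=; last first.
    exact: index_enum_uniq.
  rewrite (eq_bigr (fun i => (t i - s i)%:E)) ?sumEFin ?lte_fin//.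
  move=> i _; rewrite integral_cst//= mul1e lebesgue_measure_itv/= lte_fin.
  by case: ltgtP (st i) => // ->; rewrite subrr.
apply: le_lt_trans H.
rewrite /Rintegral ge0_integral_bigsetU//=; last 2 first.
- exact: index_enum_uniq.
- apply: measurable_funTS; apply/measurable_EFinP; apply: measurableT_comp => //.
  by have /integrableP[/measurable_EFinP] := inth.
have fin i : (\int[mu]_(x in `]s i, t i[) (`|h x|)%:E)%E \is a fin_num.
  apply: integrable_fin_num => //.
  by have := integrable_abse (inthS (measurable_itv `]s i, t i[)).
rewrite (eq_bigr (fun i => (\int[mu]_(x in `]s i, t i[) `|h x|)%:E)); last first.
  by move=> i _; rewrite fineK//; exact: fin.
rewrite sumEFin/=; apply: ler_sum => i _; rewrite PB//.
by apply: le_normr_Rintegral => //; exact: inthS.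
Qed.

Let P_dist (e : R) : 0 < e -> exists2 d : R, 0 < d &
  forall x y, `|y - x| < d -> `|P y - P x| < e.
Proof.
move=> e0; have [d d0 H] := P_abs_cont e0; exists d => // x y.
wlog xy : x y / x <= y => [W|].
  have /orP[|] := le_total x y; first exact: W.
  by move=> yx; rewrite distrC (distrC (P _)); exact: W.
move=> yx; have := H 1%N (fun=> x) (fun=> y); rewrite !big_ord1; apply => //.
  by move=> i j _ _ _; rewrite !ord1.
by move: yx; rewrite ger0_norm ?subr_ge0.
Qed.

(** Continuity on the whole line is recorded because [W23_complete] integrates such a function over
    a segment larger than [a, b]. *)
Lemma W21_primitive (c : R) : exists f, [/\ W21 a b f, continuous f, f a = c,
  L2_deriv a b f g &
  forall x, x \in `[a, b] -> f x = c + \int[mu]_(t in `[a, x]) g t].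
Proof.
exists (fun x => c + (P x - P a)).
have fg : {ae mu, forall x, x \in `[a, b] ->
    is_deriv_on a b (fun x => c + (P x - P a)) x (g x)}.
  have := FTC1Ny (fun y => inthS (measurable_itv `]-oo, y]))
    (open_integrable_locally openT inth).
  have aeF := ae_filter_ringOfSetsType mu.
  apply: filterS => x Px xab.
  have : is_deriv_on a b P x (h x) by exact: derivable_is_deriv_on.
  rewrite /h patchE mem_set// /is_deriv_on.
  rewrite (_ : (fun y => (P y - P x) / (y - x)) =
    (fun y => (c + (P y - P a) - (c + (P x - P a))) / (y - x)))//.
  by apply/funext => y; congr (_ / _); lra.
split=> //.
- split; last by exists g.
  move=> e /P_abs_cont[d d0 H]; exists d => // n s t st dis sd.
  rewrite (eq_bigr (fun i => `|P (t i) - P (s i)|)).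
    by apply: H => // i; have [] := st i.
  by move=> i _; congr (`|_|); lra.
- move=> x; apply/cvgrPdist_lt => e /P_dist[d d0 H]; exists d => //= y xy.
  by have := H y x xy; rewrite (_ : P x - P y =
    c + (P x - P a) - (c + (P y - P a)))//; lra.
- by rewrite subrr addr0.
move=> x /[dup] xab; rewrite in_itv/= => /andP[ax xb]; congr (_ + _).
rewrite PB// Rintegral_itv_bndo_bndc; last exact: inthS.
rewrite Rintegral_itv_obnd_cbnd; last exact: inthS.
apply: eq_Rintegral => t; rewrite inE/= in_itv/= => /andP[at_ tx].
by rewrite /h patchE mem_set//= in_itv/= at_ (le_trans tx).
Qed.

End primitive.
End W21_theory.

(** * Point evaluations and completeness in W_2^1 *)

Section W21_hilbert.
Context {R : realType}.
Notation mu := (@lebesgue_measure R).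
Variables (a b : R).
Hypothesis ab : a < b.
Implicit Types f g h : R -> R.

Let sip := W21_sip ab.

(* The kernel is tested against the constant 1 and against a primitive [u] of
   the derivative of [K = G x]: the former gives [K a = 1], the latter
   [||K||^2 = u x], which by AM-GM is at most
   [1 + (b - a) / 2 + (||K||^2 - 1) / 2]. *)
Lemma reproducing_kernelW21_norm G x : reproducing_kernelW21 a b G ->
  x \in `[a, b] -> ipW21 a b (G x) (G x) <= 1 + (b - a).
Proof.
move=> GP xab; have [WK KP] := GP _ xab; have [k' Kk'] := W21_L2_deriv WK.
have Lk' := Kk'.1; have mk' := Lfun2_measurable Lk'.
have L0 : (fun=> 0) \in Lfun mu 2%:E.
  apply: Lfun2P => //; rewrite (_ : _ \o _ = cst 0%E); first exact: integrable0.
  by apply/funext => y /=; rewrite expr0n.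
have [c1 [Wc _ c1a Lc c1E]] := W21_primitive a b L0 1.
have Ka : G x a = 1.
  have := KP _ Wc; rewrite (ipW21_L2_deriv ab Lc Kk') (c1E x)// c1a mul1r.
  under eq_Rintegral do rewrite mul0r.
  by rewrite !Rintegral_cst// !mul0r !addr0.
have [u [Wu _ ua Lu uE]] := W21_primitive a b Lk' 1.
have := KP _ Wu; rewrite (ipW21_L2_deriv ab Lu Kk') (uE x)// ua.
rewrite (ipW21_L2_deriv ab Kk' Kk') Ka.
set I := \int[mu]_(t in `[a, b]) (k' t * k' t).
have xab' : a <= x <= b by move: xab; rewrite in_itv.
have [ax xb] := andP xab'.
suff : \int[mu]_(t in `[a, x]) k' t <= (b - a) / 2 + I / 2 by lra.
have iab1 : mu.-integrable `[a, b] (EFin \o cst (2^-1 : R)).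
  apply: continuous_compact_integrable; first exact: segment_compact.
  by apply: continuous_subspaceT => y; exact: cst_continuous.
have ik2 := Lfun2_integrableM (measurable_itv `[a, b]) Lk' Lk'.
have ik2' : mu.-integrable `[a, b] (EFin \o (fun t => 2^-1 * (k' t * k' t))).
  have : mu.-integrable `[a, b] (fun t => 2^-1%:E * (k' t * k' t)%:E)%E.
    by apply: integrableZl => //; exact: ik2.
  by [].
have -> : (b - a) / 2 + I / 2 =
    \int[mu]_(t in `[a, b]) (2^-1 + 2^-1 * (k' t * k' t)).
  rewrite RintegralD// RintegralZl//.
  by rewrite Rintegral_cst//= lebesgue_measure_itv/= lte_fin ab /= -/I; lra.
have sub : `[a, x] `<=` `[a, b] by apply: subset_itvl; rewrite bnd_simp.
rewrite -[X in Rintegral _ X _](setIidr sub) Rintegral_mkcondr.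
apply: le_Rintegral => //.
- rewrite -restrict_EFin; apply/integrable_restrict => //.
  rewrite (setIidr sub); apply: (@integrableS _ _ _ mu `[a, b]) => //.
  exact: Lfun2_integrable_segment.
- by apply: (integrableD _ iab1 ik2').
move=> t _; rewrite patchE; case: ifP => _; last first.
  change (0 <= 2^-1 + 2^-1 * (k' t * k' t)).
  by have := sqr_ge0 (k' t); lra.
by have := sqr_ge0 (k' t - 1); lra.
Qed.

Lemma W21_point_bound G f x : reproducing_kernelW21 a b G -> W21 a b f ->
  x \in `[a, b] -> f x ^+ 2 <= (1 + (b - a)) * ipW21 a b f f.
Proof.
move=> GP Wf xab; have [WK KP] := GP _ xab; rewrite -KP//.
apply: le_trans (sip_cauchy_schwarz sip Wf WK) _; rewrite mulrC.
by apply: ler_wpM2r; [exact: (sip_ge0 sip)|exact: reproducing_kernelW21_norm].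
Qed.

(** The squared norm is the square of the value at [a] plus the squared L^2 norm of the derivative,
    so both parts are Cauchy. The limit is the primitive of the L^2 limit of the derivatives that
    starts at the limit of the values at [a]. *)
Lemma W21_complete (f : nat -> R -> R) : (forall n, W21 a b (f n)) ->
  (forall e : R, 0 < e -> exists N, forall m n, (N <= m)%N -> (N <= n)%N ->
    ipW21 a b (fun x => f m x - f n x) (fun x => f m x - f n x) < e) ->
  exists w, [/\ W21 a b w, continuous w & forall e : R, 0 < e -> exists N,
    forall n, (N <= n)%N ->
    ipW21 a b (fun x => f n x - w x) (fun x => f n x - w x) < e].
Proof.
move=> Wf cf.
have /choice[g fg] n : exists g, L2_deriv a b (f n) g by exact: W21_L2_deriv.
have subE u v u' v' : L2_deriv a b u u' -> L2_deriv a b v v' ->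
    ipW21 a b (fun x => u x - v x) (fun x => u x - v x) =
    (u a - v a) ^+ 2 + \int[mu]_(x in `[a, b]) ((u' x - v' x) ^+ 2) /\
    ((\int[mu]_(x in `[a, b]) ((u' x - v' x) ^+ 2))%:E =
     \int[mu]_(x in `[a, b]) ((u' x - v' x) ^+ 2)%:E)%E.
  move=> uu' vv'; have := L2_deriv_linear (-1) vv' uu'.
  rewrite (_ : (fun x => -1 * v x + u x) = fun x => u x - v x); last first.
    by apply/funext => x; lra.
  rewrite (_ : (fun x => -1 * v' x + u' x) = fun x => u' x - v' x); last first.
    by apply/funext => x; lra.
  move=> D; split; first by rewrite (ipW21_L2_deriv ab D D).
  rewrite /Rintegral fineK//; apply: integrable_fin_num => //.
  exact: Lfun2_integrableM D.1 D.1.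
pose gD n := g n \_ `[a, b].
have mgD n : measurable_fun setT (gD n).
  apply/(measurable_restrictT _ _).1 => //.
  by apply: measurable_funTS; exact: Lfun2_measurable (fg n).1.
have cg (e : R) : 0 < e -> exists N, forall m n, (N <= m)%N -> (N <= n)%N ->
    (\int[mu]_x ((gD m x - gD n x) ^+ 2)%:E < e%:E)%E.
  move=> /cf[N HN]; exists N => m n Nm Nn.
  have [E I] := subE _ _ _ _ (fg m) (fg n).
  have := HN m n Nm Nn; rewrite E => H.
  rewrite (_ : integral _ _ _ =
      (\int[mu]_(x in `[a, b]) ((g m x - g n x) ^+ 2)%:E)%E); last first.
    rewrite [RHS]integral_mkcond; apply: eq_integral => x _.
    by rewrite /gD !patchE; case: ifP => // _; rewrite subrr expr0n.
  rewrite -I lte_fin.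
  by apply: le_lt_trans H; rewrite lerDr sqr_ge0.
have [h [mh Hh]] := @riesz_fischer _ _ _ mu gD mgD cg.
have mgh n : measurable_fun setT (fun x => (gD n x - h x) ^+ 2).
  by apply: measurable_funX; exact: measurable_funB.
have Lh : h \in Lfun mu 2%:E.
  apply: Lfun2P => //; have [N /(_ N (leqnn N)) HN] := Hh 1 ltr01.
  have iN : mu.-integrable setT (EFin \o (fun x => 2 * (gD N x - h x) ^+ 2)).
    apply: (@integrableZl _ _ _ mu _ _ 2 (EFin \o (fun x => (gD N x - h x) ^+ 2))) => //.
    apply/integrableP; split; first by apply/measurable_EFinP; exact: mgh.
    apply: le_lt_trans (ltry 1); apply: le_trans HN.
    rewrite le_eqVlt; apply/orP; left; apply/eqP.
    by apply: eq_integral => x _ /=; rewrite ger0_norm ?sqr_ge0.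
  have ig : mu.-integrable setT (EFin \o (fun x => 2 * gD N x ^+ 2)).
    apply: (@integrableZl _ _ _ mu _ _ 2 (EFin \o (fun x => gD N x ^+ 2))) => //.
    rewrite (_ : _ \o _ = (EFin \o (fun x => g N x ^+ 2)) \_ `[a, b]).
      apply/integrable_restrict => //; rewrite setTI.
      exact: Lfun2_integrableM (fg N).1 (fg N).1.
    apply/funext => x /=; rewrite /gD !patchE; case: ifP => //.
    by rewrite expr0n.
  (* The bound h^2 <= 2 (g - h)^2 + 2 g^2 amounts to (2 g - h)^2 >= 0. *)
  apply: (le_integrable _ _ _ (integrableD _ iN ig)) => //.
    by apply/measurable_EFinP; exact: measurable_funX.
  move=> x _ /=; rewrite lee_fin !ger0_norm ?sqr_ge0//; last first.
    by rewrite addr_ge0// mulr_ge0// sqr_ge0.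
  have := sqr_ge0 (2 * gD N x - h x); nra.
have cva : cvgn (fun n => f n a).
  apply/cauchy_cvgP/cauchy_exP => e e0.
  have [N HN] := cf (e ^+ 2) (exprn_gt0 2 e0); exists (f N a), N => // n /= Nn.
  have [E I] := subE _ _ _ _ (fg N) (fg n).
  have := HN N n (leqnn N) Nn; rewrite E => H.
  have : (f N a - f n a) ^+ 2 < e ^+ 2.
    by apply: le_lt_trans H; rewrite lerDl Rintegral_ge0// => *; exact: sqr_ge0.
  by rewrite -(real_normK (num_real (f N a - f n a))) ltr_pXn2r ?nnegrE ?(ltW e0).
have [w [Ww cw wa Lw _]] := W21_primitive a b Lh (limn (fun n => f n a)).
exists w; split => // e e0.
have e4 : 0 < e / 4 by rewrite divr_gt0.
have [N1 H1] := Hh _ e4.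
(* A difference below 1 in absolute value has a square no larger than that absolute value, hence
   below e / 4. *)
have := cva => /cvgrPdist_lt /(_ (Num.min 1 (e / 4))).
move=> []; first by rewrite lt_min ltr01.
move=> N2 _ H2; exists (maxn N1 N2) => n; rewrite geq_max => /andP[N1n N2n].
have [-> I] := subE _ _ _ _ (fg n) Lw.
have := H2 n N2n; rewrite /= -wa lt_min distrC => /andP[fw1 fw2].
have fw : (f n a - w a) ^+ 2 < e / 4.
  rewrite -real_normK ?num_real//; apply: le_lt_trans fw2.
  by rewrite expr2 ler_piMr// ltW.
have : \int[mu]_(x in `[a, b]) (g n x - h x) ^+ 2 <= e / 4; last by lra.
rewrite -lee_fin I; apply: le_trans (H1 n N1n).
rewrite (_ : integral _ _ _ =
    (\int[mu]_(x in `[a, b]) ((gD n x - h x) ^+ 2)%:E)%E); last first.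
  by apply: eq_integral => x xab; rewrite /gD patchE xab.
apply: ge0_subset_integral => //; first by apply/measurable_EFinP; exact: mgh.
by move=> x _; rewrite lee_fin sqr_ge0.
Qed.

End W21_hilbert.

(** * The space W_2^3 *)

Section W23_theory.
Context {R : realType}.
Variables (a b : R).
Hypothesis ab : a < b.
Implicit Types f g h : R -> R.

Lemma W23_sip : semi_inner_product (W23 a b) (ipW23 a b).
Proof.
split.
- by move=> *; exact: W23_linear.
- exact: ipW23C.
- move=> c u v w Wu Wv Ww; have Wuv := W23_linear ab c Wu Wv.
  rewrite !ipW23E// (ipW21_ext ab _ (derivn_on_linear ab c _ Wu Wv))//.
  by rewrite (sip_linear (W21_sip ab))//; exact: W23_derivn2.
- by move=> u Wu; rewrite ipW23E//; apply: (sip_ge0 (W21_sip ab)); exact: W23_derivn2.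
Qed.

Lemma derivn_onB f g j : (j <= 2)%N -> W23 a b f -> W23 a b g ->
  {in `[a, b], derivn_on a b j (fun y => f y - g y) =1
     (fun y => derivn_on a b j f y - derivn_on a b j g y)}.
Proof.
move=> j2 Wf Wg x xab; have := derivn_on_linear ab (-1) j2 Wg Wf xab.
rewrite (_ : (fun y => -1 * g y + f y) = fun y => f y - g y).
  by move=> ->; lra.
by apply/funext => y; lra.
Qed.

Lemma ipW23B f g : W23 a b f -> W23 a b g ->
  ipW23 a b (fun x => f x - g x) (fun x => f x - g x) =
  ipW21 a b (fun x => derivn_on a b 2 f x - derivn_on a b 2 g x)
            (fun x => derivn_on a b 2 f x - derivn_on a b 2 g x).
Proof.
move=> Wf Wg; have Wfg := sip_closedB W23_sip Wf Wg; rewrite ipW23E//.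
have E := derivn_onB (isT : 2 <= 2)%N Wf Wg.
by rewrite (ipW21_ext ab _ E) ipW21C (ipW21_ext ab _ E).
Qed.

Lemma derivable1_subC f (c x l : R) : derivable f x 1 /\ derive1 f x = l ->
  derivable (fun y => f y - c) x 1 /\ derive1 (fun y => f y - c) x = l.
Proof.
move=> [df dfx]; have dc : derivable (cst c : R -> R) x 1 by exact: derivable_cst.
have -> : (fun y => f y - c) = f - cst c by [].
split; first exact: (derivableB df dc).
by rewrite derive1E (deriveB df dc) derive_cst subr0 -derive1E.
Qed.

(** Integrating from a point [l] left of [a] up to beyond [b] gives two-sided derivatives at [a] and
    [b] too; subtracting [I a] restores the value 0 at [a]. *)
Lemma continuous_primitive f (lo l u hi : R) : lo < l -> l < a -> b < u ->
  u < hi -> (forall x : R, lo < x < hi -> {for x, continuous f}) ->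
  exists F : R -> R, F a = 0 /\
    forall x : R, l < x < u -> derivable F x 1 /\ derive1 F x = f x.
Proof.
move=> lol la bu uhi cf.
have lu : l < u by exact: lt_trans (lt_trans la ab) bu.
have intf : (@lebesgue_measure R).-integrable `[l, u] (EFin \o f).
  apply: continuous_compact_integrable; first exact: segment_compact.
  apply: continuous_in_subspaceT => x; rewrite inE/= in_itv/= => /andP[lx xu].
  by apply: cf; rewrite (lt_le_trans lol lx) (le_lt_trans xu uhi).
pose I x := \int[@lebesgue_measure R]_(t in `[l, x]) f t.
exists (fun x => I x - I a); split; first by rewrite subrr.
move=> x /andP[lx xu].
apply: derivable1_subC; apply: (continuous_FTC1_closed xu intf lx).
by apply: cf; rewrite (lt_trans lol lx) (lt_trans xu uhi).
Qed.

Lemma W23_complete (s : nat -> R -> R) : (forall n, W23 a b (s n)) ->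
  (forall e : R, 0 < e -> exists N, forall m n, (N <= m)%N -> (N <= n)%N ->
    ipW23 a b (fun x => s m x - s n x) (fun x => s m x - s n x) < e) ->
  exists w, W23 a b w /\ forall e : R, 0 < e -> exists N, forall n, (N <= n)%N ->
    ipW23 a b (fun x => s n x - w x) (fun x => s n x - w x) < e.
Proof.
move=> Ws cs.
have Ws2 n := W23_derivn2 (Ws n).
have [|w2 [Ww2 cw2 Hw2]] := W21_complete ab Ws2.
  move=> e /cs[N HN]; exists N => m n Nm Nn.
  by have := HN m n Nm Nn; rewrite ipW23B.
(* Every integration uses up a margin: [w1] is differentiable, hence continuous, on ]a - 2, b + 2[,
   and [w] is then differentiable on ]a - 1, b + 1[. *)
have [|||||w1 [w1a w1E]] := @continuous_primitive w2 (a - 3) (a - 2) (b + 2) (b + 3);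
  [lra|lra|lra|lra|by move=> x _; exact: cw2|].
have [|||||w [wa wE]] := @continuous_primitive w1 (a - 2) (a - 1) (b + 1) (b + 2);
  [lra|lra|lra|lra| |].
  move=> x /w1E[dw1 _].
  by apply: differentiable_continuous; exact/derivable1_diffP.
have aab : a \in `[a, b] by rewrite in_itv/= lexx ltW.
have d0 x : x \in `[a, b] -> is_deriv_on a b w x (w1 x).
  rewrite in_itv/= => /andP[ax xb]; apply: derivable_is_deriv_on; apply: wE.
  by apply/andP; split; lra.
have d1 x : x \in `[a, b] -> is_deriv_on a b w1 x (w2 x).
  rewrite in_itv/= => /andP[ax xb]; apply: derivable_is_deriv_on; apply: w1E.
  by apply/andP; split; lra.
have E1 : {in `[a, b], w1 =1 deriv_on a b w}.
  by move=> x xab; rewrite (deriv_onE ab xab (d0 _ xab)).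
have E2 : {in `[a, b], w2 =1 derivn_on a b 2 w}.
  move=> x xab; rewrite [RHS]/= -(deriv_on_ext E1)//.
  by rewrite (deriv_onE ab xab (d1 _ xab)).
have Ww : W23 a b w.
  have [acw Lw] := W21_ext E2 Ww2; split => //.
    split; first by move=> x xab; exists (w1 x); exact: d0.
    apply: (derivable_on_ext E1) => x xab; exists (w2 x); exact: d1.
  by rewrite -E1.
exists w; split=> // e /Hw2[N HN]; exists N => n Nn; rewrite ipW23B//.
have E : {in `[a, b], (fun x => derivn_on a b 2 (s n) x - w2 x) =1
    (fun x => derivn_on a b 2 (s n) x - derivn_on a b 2 w x)}.
  by move=> x xab; rewrite E2.
by rewrite -(ipW21_ext ab _ E) ipW21C -(ipW21_ext ab _ E); exact: HN.
Qed.

(** Near [x] the difference quotient is at most |l| + 1 in absolute value. *)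
Lemma is_deriv_on_dist f (x l : R) : is_deriv_on a b f x l ->
  forall e : R, 0 < e -> exists2 d : R, 0 < d &
    forall y, y \in `[a, b] -> `|y - x| < d -> `|f y - f x| < e.
Proof.
move=> /is_deriv_onP /(_ 1 ltr01)[d d0 H] e e0.
have l1 : 0 < `|l| + 1 by rewrite ltr_wpDl.
exists (Num.min d (e / (`|l| + 1))); first by rewrite lt_min d0 divr_gt0.
move=> y yab; rewrite lt_min => /andP[yd ye].
have [->|yx] := eqVneq y x; first by rewrite subrr normr0.
have yx0 : y - x != 0 by rewrite subr_eq0.
have q : `|(f y - f x) / (y - x)| <= `|l| + 1.
  rewrite -[X in `|X|](subrK l); apply: le_trans (ler_normD _ _) _.
  by rewrite addrC lerD2l ltW// H.
rewrite -[X in `|X|](divfK yx0) normrM.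
apply: le_lt_trans (ler_wpM2r (normr_ge0 _) q) _.
by rewrite mulrC -ltr_pdivlMr.
Qed.

Lemma is_deriv_on_is_derive f (x l : R) : a < x < b -> is_deriv_on a b f x l ->
  is_derive x 1 f l.
Proof.
move=> /andP[ax xb] /is_deriv_onP H.
have : (fun h : R => h^-1 *: (f (h *: 1 + x) - f x)) @ 0^' --> l.
  apply/cvgrPdist_lt => e /H[d d0 Hd].
  exists (Num.min d (Num.min (x - a) (b - x))).
    by rewrite /= !lt_min d0 !subr_gt0 ax.
  move=> y /= + y0; rewrite sub0r normrN !lt_min => /and3P[yd].
  move=> /ltr_normlP[y3 y4] /ltr_normlP[y5 y6].
  rewrite [y%:A]mulr1 distrC [_ *: _]mulrC.
  have := Hd (y + x); rewrite addrK; apply.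
  - by rewrite in_itv/=; apply/andP; split; lra.
  - by rewrite -subr_eq0 addrK.
  - by [].
move=> cl; apply: DeriveDef; first exact: cvgP cl.
exact: cvg_lim cl.
Qed.

Lemma deriv_on_bound f (B : R) : derivable_on a b f -> f a = 0 -> 0 <= B ->
  (forall x, x \in `[a, b] -> `|deriv_on a b f x| <= B) ->
  forall x, x \in `[a, b] -> `|f x| <= B * (b - a).
Proof.
move=> df fa B0 fB x; rewrite in_itv/= => /andP[].
rewrite le_eqVlt => /predU1P[<- _|ax xb].
  by rewrite fa normr0 mulr_ge0// subr_ge0 ltW.
have sub y : y \in `[a, x] -> y \in `[a, b].
  by rewrite !in_itv/= => /andP[-> /le_trans ->].
have [||c cax] := @MVT _ f (deriv_on a b f) a x ax.
- move=> y; rewrite in_itv/= => /andP[ay yx].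
  apply: is_deriv_on_is_derive; first by rewrite ay (lt_le_trans yx).
  by apply: deriv_on_is_deriv => //; rewrite in_itv/= ltW//= ltW// (lt_le_trans yx).
- apply/subspace_continuousP => y /= /sub yab; apply/cvgrPdist_lt => e e0.
  have [d d0 H] := is_deriv_on_dist (deriv_on_is_deriv ab df yab) e0.
  exists d => //= z yz /sub zab; rewrite distrC; apply: H => //.
  by rewrite distrC.
rewrite fa subr0 => ->; rewrite normrM ler_pM//.
  apply: fB; apply: sub; exact: subset_itv_oo_cc cax.
by rewrite gtr0_norm ?subr_gt0// lerD2r.
Qed.

Lemma W23_derivn_bound G : reproducing_kernelW21 a b G ->
  exists2 C : R, 0 < C & forall f j x, W23 a b f -> (j <= 2)%N ->
    x \in `[a, b] -> `|derivn_on a b j f x| <= C * Num.sqrt (ipW23 a b f f).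
Proof.
move=> GP; pose c := b - a; have c0 : 0 < c by rewrite subr_gt0.
pose M := Num.sqrt (1 + c); have M0 : 0 < M by rewrite sqrtr_gt0; lra.
(* [M] bounds point evaluation on W_2^1, hence the second derivative. Each passage to the next lower
   derivative costs a factor [c], and the sum of the three bounds serves all j <= 2. *)
exists (M * (1 + c + c * c)); first by rewrite mulr_gt0//; nra.
move=> f j x Wf; set N := Num.sqrt _; have N0 : 0 <= N by exact: sqrtr_ge0.
have MN0 : 0 <= M * N by rewrite mulr_ge0// ltW.
have H2 y : y \in `[a, b] -> `|derivn_on a b 2 f y| <= M * N.
  move=> yab; rewrite -sqrtrM; last by lra.
  rewrite -sqrtr_sqr; apply: ler_wsqrtr; rewrite ipW23E//.
  exact: (W21_point_bound ab GP (W23_derivn2 Wf)).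
case: (Wf) => [[df1 df2] _ _ [fa dfa]].
have H1 y : y \in `[a, b] -> `|derivn_on a b 1 f y| <= M * N * c.
  exact: (deriv_on_bound df2 dfa).
have H0 y : y \in `[a, b] -> `|f y| <= M * N * c * c.
  by apply: (deriv_on_bound df1 fa) => //; rewrite mulr_ge0// ltW.
have E : M * (1 + c + c * c) * N = M * N + M * N * c + M * N * c * c by ring.
have p1 : 0 <= M * N * c by rewrite mulr_ge0// ltW.
have p2 : 0 <= M * N * c * c by rewrite mulr_ge0// ltW.
rewrite E; case: j => [|[|[|//]]] _ xab.
- apply: le_trans (H0 _ xab) _; lra.
- apply: le_trans (H1 _ xab) _; lra.
- apply: le_trans (H2 _ xab) _; lra.
Qed.

(** Serves twice: with the set of nodes [x i], and with the open interval, to reach its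
    endpoints. *)
Lemma abs_continuous_dense_eq f g (P : set R) :
  abs_continuous a b f -> abs_continuous a b g -> P `<=` `[a, b] ->
  `[a, b] `<=` closure P -> (forall x, P x -> f x = g x) ->
  {in `[a, b], f =1 g}.
Proof.
move=> acf acg Pab dP fg x xab; apply/eqP; rewrite -subr_eq0 -normr_le0.
apply/ler_addgt0Pl => e e0; rewrite addr0.
have e2 : 0 < e / 2 by rewrite divr_gt0.
have [d1 d10 H1] := abs_continuous_dist acf xab e2.
have [d2 d20 H2] := abs_continuous_dist acg xab e2.
have d0 : 0 < Num.min d1 d2 by rewrite lt_min d10.
have [y [Py]] := dP x xab (ball x (Num.min d1 d2)) (nbhsx_ballx _ _ d0).
rewrite /ball/= distrC lt_min => /andP[y1 y2].
have yab := Pab _ Py.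
have F := H1 y yab y1; have G' := H2 y yab y2.
rewrite -(fg _ Py) in G'.
rewrite (_ : f x - g x = (f y - g x) - (f y - f x)); last by lra.
by apply: le_trans (ler_normB _ _) _; lra.
Qed.

End W23_theory.

(** * Fourier series for the functions obtained from the kernel by the adjoint *)

Section kernel_gram_schmidt.
Context {R : realType}.
Variables (a T k : R).
Hypothesis aT : a < T.
Hypothesis L_bounded : bounded_linear_op a T (Lop a T k).
Hypothesis L_inj : injective_op a T (Lop a T k).
Variable G : R -> R -> R.
Hypothesis G_kernel : reproducing_kernelW21 a T G.
Variable Lstar : (R -> R) -> R -> R.
Hypothesis Lstar_adjoint : adjoint_op a T (Lop a T k) Lstar.
Variable x : nat -> R.
Hypothesis x_in : forall i, x i \in `[a, T].

Let psi i := Lstar (G (x i)).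
Let ip := ipW23 a T.
Let sip := W23_sip aT.

Lemma adjoint_kernel_closed i : W23 a T (psi i).
Proof. by have [WG _] := G_kernel (x_in i); have [] := Lstar_adjoint WG. Qed.

Lemma adjoint_kernel_eval u i : W23 a T u -> ip u (psi i) = Lop a T k u (x i).
Proof.
move=> Wu; have [WG GP] := G_kernel (x_in i); have [_ LP] := Lstar_adjoint WG.
by have [LW _ _] := L_bounded; rewrite /ip -LP// GP//; exact: LW.
Qed.

Lemma fourier_sum_cvg v : W23 a T v -> exists w, W23 a T w /\
  forall e : R, 0 < e -> exists N, forall n, (N <= n)%N ->
    ip (fun t => fourier_sum ip psi v n t - w t)
       (fun t => fourier_sum ip psi v n t - w t) < e.
Proof.
move=> Wv; apply: W23_complete => //.
  by move=> n; exact: (fourier_sum_closed sip adjoint_kernel_closed).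
exact: (fourier_sum_cauchy sip adjoint_kernel_closed).
Qed.

Lemma dense_complete z : `[a, T] `<=` closure (range x) -> W23 a T z ->
  (forall i, ip z (psi i) = 0) -> {in `[a, T], z =1 (fun=> 0)}.
Proof.
move=> xd Wz z0; have W0 := sip_closed0 sip Wz.
have [LW Llin _] := L_bounded; apply: L_inj => //.
apply: (@abs_continuous_dense_eq _ _ _ _ _ (range x)) => //.
- by have [] := LW _ Wz.
- by have [] := LW _ W0.
- by move=> _ [i _ <-]; exact: x_in.
(* The image of the zero function is also evaluated through [psi i]; this avoids unfolding [Lop],
   whose value at 0 is a limit. *)
move=> _ [i _ <-]; rewrite -(adjoint_kernel_eval i Wz) -(adjoint_kernel_eval i W0) z0.
by apply/esym; exact: (sip0l sip Wz (adjoint_kernel_closed i)).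
Qed.

Lemma fourier_sum_cvg_dense v : `[a, T] `<=` closure (range x) -> W23 a T v ->
  forall e : R, 0 < e -> exists N, forall n, (N <= n)%N ->
    ip (fun t => fourier_sum ip psi v n t - v t)
       (fun t => fourier_sum ip psi v n t - v t) < e.
Proof.
move=> xd Wv; have [w [Ww cw]] := fourier_sum_cvg Wv.
have vw : {in `[a, T], (fun t => v t - w t) =1 (fun=> 0)}.
  apply: dense_complete => //; first exact: (sip_closedB sip).
  exact: (fourier_limit_orthogonal sip adjoint_kernel_closed Wv Ww cw).
move=> e /cw[N HN]; exists N => n /HN.
set f := fun t => _ - w t; set g := fun t => _ - v t.
have fg : {in `[a, T], f =1 g}.
  by move=> t tab; have := vw _ tab; rewrite /f /g; lra.
by rewrite /ip (ipW23_ext aT f fg) ipW23C (ipW23_ext aT g fg).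
Qed.

Lemma fourier_sum_derivn_cvg v : `[a, T] `<=` closure (range x) -> W23 a T v ->
  forall e : R, 0 < e -> exists N, forall n, (N <= n)%N ->
  forall j t, (j <= 2)%N -> t \in `[a, T] ->
    `|derivn_on a T j (fourier_sum ip psi v n) t - derivn_on a T j v t| < e.
Proof.
move=> xd Wv e e0; have [C C0 HC] := W23_derivn_bound aT G_kernel.
have eC : 0 < e / C by rewrite divr_gt0.
have [N HN] := fourier_sum_cvg_dense xd Wv (exprn_gt0 2 eC).
exists N => n Nn j t j2 tab.
have Ws := fourier_sum_closed sip adjoint_kernel_closed v n.
rewrite -(derivn_onB aT j2 Ws Wv tab).
apply: le_lt_trans (HC _ _ _ (sip_closedB sip Ws Wv) j2 tab) _.
rewrite mulrC -ltr_pdivlMr// -[ltRHS](gtr0_norm eC) -sqrtr_sqr ltr_sqrt.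
  exact: HN.
exact: exprn_gt0.
Qed.

End kernel_gram_schmidt.

(** * The equation on the closed segment, and the theorem *)

Lemma segment_sub_closure (R : realType) (a b : R) : a < b ->
  `[a, b] `<=` closure (`]a, b[ : set R).
Proof.
move=> ab x; rewrite /= in_itv/= => /andP[ax xb] B /nbhs_ballP[d /= d0 dB].
pose m := Num.min d (b - a) / 4.
have m0 : 0 < m by rewrite divr_gt0// lt_min d0 subr_gt0.
have md : m < d by rewrite /m; have : Num.min d (b - a) <= d; [rewrite ge_min lexx|lra].
have mb : m <= (b - a) / 4.
  by rewrite /m ler_pM2r ?invr_gt0// ge_min lexx orbT.
(* A step of at most a quarter of the length, towards the farther endpoint, lands strictly
   inside. *)
have [xm|xm] := leP x ((a + b) / 2).
  exists (x + m); split; first by rewrite /= in_itv/=; apply/andP; split; lra.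
  by apply: dB; rewrite /ball/= opprD addrA subrr add0r normrN gtr0_norm.
exists (x - m); split; first by rewrite /= in_itv/=; apply/andP; split; lra.
by apply: dB; rewrite /ball/= subKr gtr0_norm.
Qed.

(** Both sides are absolutely continuous and agree on the open interval, hence also at the
    endpoints, which may be among the nodes. *)
Lemma Lop_IVP_solution (R : realType) (a T k : R) (F : R -> R -> R) (u : R -> R) :
  a < T -> W21 a T (Lop a T k u) -> W21 a T (fun x => F x (u x)) ->
  IVP_solution a T k F u ->
  {in `[a, T], Lop a T k u =1 (fun x => F x (u x))}.
Proof.
move=> aT [acL _] [acF _] [_ LF _ _].
apply: (@abs_continuous_dense_eq _ _ _ _ _ `]a, T[) => //.
- exact: subset_itv_oo_cc.
- exact: segment_sub_closure.
Qed.
(* Sequences are indexed from 0. *)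
Theorem mainTheorem1 (R : realType) (a T k : R) (aT : a < T)
    (L_bounded : bounded_linear_op a T (Lop a T k))
    (L_inj : injective_op a T (Lop a T k))
    (F : R -> R -> R)
    (F_analytic : analytic2_on a T F)
    (F_W21 : forall y, W23 a T y -> W21 a T (fun x => F x (y x)))
    (IVP_unique : exists w : R -> R,
      [/\ IVP_solution a T k F w,
          forall w', IVP_solution a T k F w' -> {in `[a, T], w' =1 w}
        & analytic_on a T w])
    (G : R -> R -> R) (G_kernel : reproducing_kernelW21 a T G)
    (Lstar : (R -> R) -> R -> R)
    (Lstar_adjoint : adjoint_op a T (Lop a T k) Lstar)
    (x : nat -> R) (x_in : forall i, x i \in `[a, T]) (x_inj : injective x)
    (psi : nat -> R -> R) (psi_def : forall i, psi i = Lstar (G (x i)))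
    (psibar : nat -> R -> R)
    (psibar_def : forall i, psibar i = gram_schmidt (ipW23 a T) psi i)
    (beta : nat -> nat -> R)
    (beta_coef : forall i, {in `[a, T],
      psibar i =1 (fun t => \sum_(j < i.+1) beta i j * psi j t)})
    (beta_pos : forall i, 0 < beta i i) :
  (forall v, W23 a T v ->
    exists2 w, W23 a T w &
      normW23 a T (fun t =>
        \sum_(i < n) ipW23 a T v (psibar i) * psibar i t - w t)
        @[n --> \oo] --> (0 : R)) /\
  (`[a, T]%classic `<=` closure (range x) ->
   forall u, IVP_solution a T k F u ->
    (forall t, t \in `[a, T] ->
      series (fun i =>
        (\sum_(j < i.+1) beta i j * F (x j) (u (x j))) * psibar i t)
        @ \oo --> u t) /\
    (let u_ n t := \sum_(i < n)
       (\sum_(j < i.+1) beta i j * F (x j) (u (x j))) * psibar i t in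
     forall j : nat, (j <= 2)%N ->
       {uniform `[a, T]%classic,
         (fun n => derivn_on a T j (u_ n)) @ \oo --> derivn_on a T j u})).
Proof.
have psiE : psi = fun i => Lstar (G (x i)) by apply/funext.
have Wpsi i : W23 a T (psi i).
  by rewrite psi_def; exact: (adjoint_kernel_closed G_kernel Lstar_adjoint x_in).
have psibarE : psibar = gram_schmidt (ipW23 a T) psi by apply/funext.
have sumE v n : (fun t => \sum_(i < n) ipW23 a T v (psibar i) * psibar i t) =
    fourier_sum (ipW23 a T) psi v n.
  by rewrite psibarE.
split.
  move=> v Wv; rewrite psiE in sumE.
  have [w [Ww cw]] := fourier_sum_cvg aT G_kernel Lstar_adjoint x_in Wv.
  exists w => //; apply/cvgrPdist_lt => e e0.
  have [N HN] := cw _ (exprn_gt0 2 e0); exists N => // n /= /HN.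
  rewrite sub0r normrN ger0_norm ?sqrtr_ge0// /normW23.
  rewrite (_ : (fun t => _ - w t) = fun t =>
    fourier_sum (ipW23 a T) (fun i => Lstar (G (x i))) v n t - w t).
    by move=> H; rewrite -[ltRHS](gtr0_norm e0) -sqrtr_sqr ltr_sqrt// exprn_gt0.
  by rewrite -sumE.
move=> xd u IVPu; have [Wu _ _ _] := IVPu.
have [LW _ _] := L_bounded.
have LF := Lop_IVP_solution aT (LW _ Wu) (F_W21 _ Wu) IVPu.
(* Expanding [psibar i] by [beta_coef] turns the Fourier coefficient into a combination of the
   values of [Lop a T k u] at the nodes, where the equation applies. *)
have coefE i : \sum_(j < i.+1) beta i j * F (x j) (u (x j)) =
    ipW23 a T u (psibar i).
  rewrite ipW23C (ipW23_ext aT _ (beta_coef i)) ipW23C.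
  rewrite (sip_sumr (W23_sip aT) i.+1 (beta i) Wpsi Wu).
  apply: eq_bigr => j _; congr (_ * _); rewrite psi_def.
  rewrite (adjoint_kernel_eval L_bounded G_kernel Lstar_adjoint x_in)//.
  by rewrite LF.
have uE n : (fun t => \sum_(i < n)
    (\sum_(j < i.+1) beta i j * F (x j) (u (x j))) * psibar i t) =
    fourier_sum (ipW23 a T) (fun i => Lstar (G (x i))) u n.
  rewrite -psiE -sumE; apply/funext => t.
  by apply: eq_bigr => i _; rewrite coefE.
have cu := fourier_sum_derivn_cvg aT L_bounded L_inj G_kernel Lstar_adjoint x_in
  xd Wu.
split.
  (* Pointwise convergence is the case j = 0 of the uniform estimate [cu]. *)
  move=> t tab; apply/cvgrPdist_lt => e /cu[N HN]; exists N => // n /= Nn.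
  rewrite distrC; have := HN n Nn 0%N t isT tab; rewrite -uE.
  by rewrite /series/= big_mkord.
move=> u_ j j2 W /uniform_nbhs[E [+ EW]].
rewrite -entourage_ballE => -[e /= e0 eE].
have [N HN] := cu _ e0; exists N => // n /= Nn; apply: EW => t /= tab.
apply: eE; rewrite /= /ball/= distrC.
by have := HN n Nn j t j2 tab; rewrite -uE.
Qed.
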